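(* Let $s=\lceil\log_2 k\rceil$ and $n\ge k^2$. Let $\mathbb{C}'$ be the flash code, storing $k$ bits in $n$ $q$-level cells, defined by the sequence of decoding/encoding maps $\mathcal{D}_0,\mathcal{D}_1,\dots,\mathcal{D}_{s-1}$ and $\mathcal{E}_0,\mathcal{E}_1,\dots,\mathcal{E}_{s-1}$ that use stacked binary indexing (all described in the context). The write deficiency of $\mathbb{C}'$ is at most $O(qk\log k)$ if $q\ge\log_2 k$, and at most $O(k\log^2 k)$ otherwise.
   Context: **Flash codes.** Let $\mathcal{A}_q=\{0,\dots,q-1\}$. The state of $n$ cells is a vector in $\mathcal{A}_q^n$, initially all-zero. A flash code storing $k$ bits $(v_0,\dots,v_{k-1})$ has a decoding map from cell states to $\{0,1\}^k$ and an encoding map. Given the current state $x$ and an index $i$, the encoding map returns either a state $y$ with $y_j\ge x_j$ for all $j$ whose decoded vector differs from that of $x$ exactly in position $i$, or the symbol $\mathsf{E}$ (block erasure required). A write is a change of one bit. The code guarantees $t$ writes if no sequence of up to $t$ writes from the initial state leads to $\mathsf{E}$. Its write deficiency is then $n(q-1)-t$. **Terminology.** A block of cells is full if all its cells are at the maximal level, empty if all are at level $0$, active if neither, and live if not full. The parity of a block is the sum of its levels mod 2. To increment a live block is to raise some cell of it by one level. **Set-up.** Assume $k=2^s$; otherwise the same code is used for $2^s>k$ bits, the last $2^s-k$ being set to zero. Some cells are set aside as index cells (see below). The other cells are partitioned into $m$ blocks of $k$ cells, fewer than $k$ leftover cells being unused. **Stage 0 ($\mathcal{D}_0,\mathcal{E}_0$).**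 Each active block of $k$ cells, numbered $0,\dots,k-1$, represents one bit, whose value is the parity of the block. A block representing bit $i$ is filled by raising cell $i$ one level at a time from $0$ to $q-1$, then cell $i+1$, and so on cyclically modulo $k$. Hence $i$ can be read from any active block: it is the position cyclically following the run of zero cells or, if there are no zeros, the position following the unique cell of level less than $q-1$. $\mathcal{D}_0$ sets all bits to $0$ and then, for each active block, sets the bit it represents to its parity. $\mathcal{E}_0$, on a change of bit $i$, performs the next one-level increase in the active block representing bit $i$. If there is none, it takes the first empty block and sets its cell $i$ to $1$. If there is no empty block, it returns $\mathsf{E}$. **Transition $\mathcal{T}_r$ ($1\le r\le s-1$)**, invoked when stage $r-1$ has produced $\mathsf{E}$. Stage $r$ has a batch of $2(k-1)$ index blocks $u_1,\dots,u_{2k-2}$; each holds a number, and ''full'' means its maximal value. Re-partition the $k$-cell blocks into $2^rm$ parity blocks of $k/2^r$ cells, and let $x_1,\dots,x_{m_r}$ be the live ones, where $m_r\le 2(k-1)$. If $m_r<k$, output $\mathsf{E}$. Otherwise set $u_i=i$ for $1\le i\le k$, $u_i=0$ for $k<i\le m_r$, and $u_i$ full for $m_r<i\le 2k-2$. Then record the current information vector: for $i=1,\dots,k$, if the parity of $x_i$ differs from $v_{i-1}$, increment $x_i$, and if $x_i$ becomes full, make $u_i$ full. **Stage $r$ ($\mathcal{D}_r,\mathcal{E}_r$).** Throughout, the $j$-th live index block corresponds to the $j$-th live parity block. $\mathcal{D}_r$ sets all bits to $0$ and then, for each live parity block whose index block has value $i\ne0$, sets $v_{i-1}$ to the parity of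 that parity block. $\mathcal{E}_r$, on a change of bit $i$, looks for a live parity block with index value $i+1$. If there is one, it is incremented, and if it becomes full its index block is made full. If there is none, the first live parity block with index value $0$ is taken: its index is set to $i+1$, it is incremented if its parity differs from the new value $v_i$, and if it becomes full its index block is made full. If no such block exists, $\mathsf{E}$ is returned. The code proceeds sequentially through stages $0,1,\dots,s-1$, passing to the next stage whenever the current one outputs $\mathsf{E}$. **Stacked binary indexing.** Each index block occupies $\mu'=\lceil\log_2(k+2)\rceil$ cells and its number is written in binary, using two consecutive levels. Batches of successive stages are stacked in the same $2(k-1)\mu'$ cells. The first batch uses levels $0$ and $1$. When its stage is over, all these cells are raised to level $1$, and the next batch uses levels $1$ and $2$ in the same cells, and so on. Thus up to $q-1$ batches share one set of $2(k-1)\mu'$ cells, and $\lceil (s-1)/(q-1)\rceil$ such sets are set aside. *)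

(* Defs.v *)
From mathcomp Require Import all_boot all_order all_algebra.
From mathcomp Require Import all_classical all_reals all_analysis.

Set Implicit Arguments.
Unset Strict Implicit.
Unset Printing Implicit Defensive.

Local Open Scope nat_scope.

(* For 0 < q, 'I_q.-1.+1 is the alphabet {0, ..., q-1}; this form of the type
   is syntactically inhabited. *)
Definition state (q n : nat) := {ffun 'I_n -> 'I_q.-1.+1}.

Definition bits (k : nat) := {ffun 'I_k -> bool}.

(* None is the erasure symbol E. *)
Record code_maps (k q n : nat) := CodeMaps {
  decode : state q n -> bits k;
  encode : state q n -> 'I_k -> option (state q n) }.

Section FlashCode.

Variables (k q n : nat) (C : code_maps k q n).

Definition initial : state q n := [ffun => ord0].

Definition write_seq (w : seq 'I_k) : option (state q n) :=
  foldl (fun o i => obind (encode C ^~ i) o) (Some initial) w.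

(* The condition on the encoding map, at every state that can occur. *)
Definition flash_code : Prop :=
  forall (w : seq 'I_k) (x y : state q n) (i : 'I_k),
    write_seq w = Some x -> encode C x i = Some y ->
    (forall j, x j <= y j) /\
    (forall l, (decode C y l != decode C x l) = (l == i)).

Definition guarantees (t : nat) : bool :=
  [forall j : 'I_t.+1, [forall w : j.-tuple 'I_k, isSome (write_seq w)]].

(* n(q-1) - t for the largest guaranteed t.  A flash code guarantees at most
   n(q-1) writes, since every write raises some cell, so bounding t by n(q-1)
   loses nothing and the subtraction is exact. *)
Definition write_deficiency : nat :=
  n * q.-1 - \max_(t < (n * q.-1).+1 | guarantees t) t.

End FlashCode.

Section Restriction.

Variables (k K q n : nat) (le_kK : k <= K).

Definition restrict_code (C : code_maps K q n) : code_maps k q n :=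
  CodeMaps (fun x => [ffun i : 'I_k => decode C x (widen_ord le_kK i)])
           (fun x i => encode C x (widen_ord le_kK i)).

End Restriction.

(* Which cell is raised when a live set of cells is incremented. *)
Definition cell_choice (q n : nat) := state q n -> {set 'I_n} -> 'I_n.

Definition valid_choice (q n : nat) (pick : cell_choice q n) : Prop :=
  forall (x : state q n) (A : {set 'I_n}),
    (exists2 j, j \in A & x j < q.-1) ->
    pick x A \in A /\ x (pick x A) < q.-1.

Definition ceil_div (a b : nat) : nat := (a + b.-1) %/ b.

Section Construction.

(* s is the number of stages; the code stores K = 2^s bits. *)
Variables (s q n : nat) (pick : cell_choice q n).

Local Notation K := (2 ^ s).

Implicit Types (x y : state q n) (v : bits K) (A : {set 'I_n}) (r b u a : nat).

Definition set_bit v (i : nat) (c : bool) : bits K :=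
  [ffun l : 'I_K => if (l : nat) == i then c else v l].

Definition zero_bits : bits K := [ffun => false].

Definition full x A : bool := [forall j in A, x j == q.-1 :> nat].
Definition empty x A : bool := [forall j in A, x j == 0 :> nat].
Definition active x A : bool := ~~ full x A && ~~ empty x A.
Definition parity x A : bool := odd (\sum_(j in A) x j).

Definition level x (p : nat) : nat :=
  oapp (fun j : 'I_n => x j : nat) 0 (insub p).

Definition raise x (p : nat) : state q n :=
  [ffun j : 'I_n => if (j : nat) == p then inord (x j).+1 else x j].

Definition increment x A : state q n := raise x (pick x A).

(* The index cells come first, followed by m blocks of K cells. *)

Definition mu' : nat := up_log 2 (K + 2).
Definition n_index_blocks : nat := 2 * (K - 1).
Definition index_set_size : nat := n_index_blocks * mu'.
Definition n_index_cells : nat := ceil_div s.-1 q.-1 * index_set_size.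

(* If n is smaller than the number of index cells then m = 0, and every write
   returns E. *)
Definition m : nat := (n - n_index_cells) %/ K.

Definition block_size r : nat := K %/ 2 ^ r.
Definition position r b (t : nat) : nat := n_index_cells + b * block_size r + t.

(* The b-th parity block of stage r, for b < 2^r m; blocks of stage 0 are the
   K-cell blocks. *)
Definition block r b : {set 'I_n} :=
  [set j : 'I_n | position r b 0 <= j < position r b (block_size r)].

Definition represented_bit x b : nat :=
  let l t := level x (position 0 b (t %% K)) in
  if has (fun t => l t == 0) (iota 0 K)
  then find (fun t => (l t != 0) && (l (t + K.-1) == 0)) (iota 0 K)
  else (find (fun t => l t < q.-1) (iota 0 K)).+1 %% K.

(* i is the cell from which the block is being filled. *)
Definition fill x b (i : nat) : state q n :=
  let l t := level x (position 0 b (t %% K)) in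
  raise x (position 0 b ((i + find (fun t => l (i + t) < q.-1) (iota 0 K)) %% K)).

Definition decode0 x : bits K :=
  foldl (fun v b => set_bit v (represented_bit x b) (parity x (block 0 b)))
        zero_bits [seq b <- iota 0 m | active x (block 0 b)].

Definition encode0 x (i : 'I_K) : option (state q n) :=
  if [seq b <- iota 0 m | active x (block 0 b) & represented_bit x b == i]
    is b :: _ then Some (fill x b i)
  else if [seq b <- iota 0 m | empty x (block 0 b)] is b :: _
       then Some (raise x (position 0 b i))
       else None.

(* Stacking: the batch of stage r >= 1 uses levels base r and base r + 1 of the
   cells first_cell r, ..., first_cell r + index_set_size - 1. *)
Definition base r : nat := r.-1 %% q.-1.
Definition first_cell r : nat := (r.-1 %/ q.-1) * index_set_size.

Definition in_batch r (p : nat) : bool :=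
  first_cell r <= p < first_cell r + index_set_size.

Definition index_position r u (t : nat) : nat := first_cell r + u * mu' + t.

Definition max_index : nat := (2 ^ mu').-1.

Definition index_value r x u : nat :=
  \sum_(t < mu') 2 ^ t * (base r < level x (index_position r u t)).

Definition set_index r x u a : state q n :=
  [ffun j : 'I_n =>
    if index_position r u 0 <= j < index_position r u mu'
    then inord (base r + odd (a %/ 2 ^ (j - index_position r u 0)))
    else x j].

(* End of stage r; stage 0 has no batch. *)
Definition close_batch r x : state q n :=
  if r == 0 then x
  else [ffun j : 'I_n => if in_batch r j then inord (base r).+1 else x j].

(* The batch of a started stage has a cell on its upper level, because its
   first index block holds a nonzero number. *)
Definition started r x : bool :=
  [exists j : 'I_n, in_batch r j && (base r < x j)].

Definition current_stage x : nat := \max_(r < s | (0 < r) && started r x) r.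

Definition live_blocks r x : seq nat :=
  [seq b <- iota 0 (2 ^ r * m) | ~~ full x (block r b)].

Definition live_indices r x : seq nat :=
  [seq u <- iota 0 n_index_blocks | index_value r x u != max_index].

(* Corresponding (index block, parity block) pairs. *)
Definition live_pairs r x : seq (nat * nat) :=
  zip (live_indices r x) (live_blocks r x).

(* Increments the parity block p.2; if it becomes full, so does p.1. *)
Definition increment_pair r x (p : nat * nat) : state q n :=
  let y := increment x (block r p.2) in
  if full y (block r p.2) then set_index r y p.1 max_index else y.

(* The index block numbered u from 0 is the (u+1)-st one. *)
Definition initial_index (live u : nat) : nat :=
  if u < K then u.+1 else if u < live then 0 else max_index.

Definition transition r v x : option (state q n) :=
  let L := live_blocks r x in
  if size L < K then None else
  let x1 := foldl (fun y u => set_index r y u (initial_index (size L) u))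
                  x (iota 0 n_index_blocks) in
  Some (foldl (fun y (i : 'I_K) =>
                 let b := nth 0 L i in
                 if parity y (block r b) != v i
                 then increment_pair r y (i : nat, b) else y)
              x1 (enum 'I_K)).

Definition decode_indexed r x : bits K :=
  foldl (fun v (p : nat * nat) =>
           if index_value r x p.1 is i.+1
           then set_bit v i (parity x (block r p.2)) else v)
        zero_bits (live_pairs r x).

Definition encode_indexed r x (i : 'I_K) : option (state q n) :=
  if [seq p <- live_pairs r x | index_value r x p.1 == i.+1] is p :: _
  then Some (increment_pair r x p)
  else if [seq p <- live_pairs r x | index_value r x p.1 == 0] is p :: _
  then let new_value := ~~ decode_indexed r x i in
       let y := set_index r x p.1 i.+1 in
       Some (if parity y (block r p.2) != new_value
             then increment_pair r y p else y)
  else None.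

Definition decode_stage r x : bits K :=
  if r == 0 then decode0 x else decode_indexed r x.

Definition encode_stage r x (i : 'I_K) : option (state q n) :=
  if r == 0 then encode0 x i else encode_indexed r x i.

(* Called when stage r has returned E and d stages are left.  A stage whose
   transition returns E allows no write, and is over at once. *)
Fixpoint next_stages (d r : nat) v x (i : 'I_K) : option (state q n) :=
  if d is d'.+1 then
    let x1 := close_batch r x in
    if transition r.+1 v x1 is Some x2 then
      if encode_stage r.+1 x2 i is Some y then Some y
      else next_stages d' r.+1 v x2 i
    else next_stages d' r.+1 v x1 i
  else None.

Definition decode_all x : bits K := decode_stage (current_stage x) x.

Definition encode_all x (i : 'I_K) : option (state q n) :=
  let r := current_stage x in
  if encode_stage r x i is Some y then Some y
  else next_stages (s.-1 - r) r (decode_all x) x i.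

Definition code_pow2 : code_maps K q n := CodeMaps decode_all encode_all.

End Construction.

(* The code for k bits, with s the ceiling of log2 k: the bits k, ..., 2^s - 1
   of the code for 2^s bits are never written. *)
Definition code_C' (k q n : nat) (pick : cell_choice q n) : code_maps k q n :=
  restrict_code (up_logP k (isT : 1 < 2)) (code_pow2 (up_log 2 k) pick).

Definition log2 (R : realType) (x : R) : R := (ln x / ln 2)%R.

(* Main.v *)
(* Every write in stage r raises at most one data cell (none when a block of the
   right parity is taken over), and a transition raises at most K = 2^s of them
   to record the current bits, so after t writes the data levels sum to at most
   t + K s.  When stage r returns E, its live blocks represent distinct bits
   other than the requested one, hence number at most K - 1; halving them leaves
   at most 2(K - 1) live blocks for stage r + 1, which therefore has enough index
   blocks.  When the last stage returns E, at most K - 1 blocks of two cells are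
   live, so at most 2(K - 1)(q - 1) + K s of the levels of the data blocks are
   lost.  The index cells and the leftover cells account for the remaining
   O((s + q) K s) + K (q - 1).

   Decoding is correct because blocks of every stage have an even number of cells:
   a full block has even parity, in agreement with the default value 0 of a bit
   that no live block represents.  The stage is read off the index cells, because
   those in the batch of a later stage do not exceed its lower level. *)

Require Import Defs.
From mathcomp Require Import all_boot all_order all_algebra.
From mathcomp Require Import all_classical all_reals all_analysis.
From mathcomp Require Import zify lra.

Set Implicit Arguments.
Unset Strict Implicit.
Unset Printing Implicit Defensive.

Local Open Scope nat_scope.

(** * Lists, binary expansions and intervals of ordinals *)

Section Sequences.

Lemma find_iota (a : pred nat) N i :
  i < N -> a i -> (forall t, t < i -> ~~ a t) -> find a (iota 0 N) = i.
Proof.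
move=> iN ai amin; rewrite -(subnKC (ltnW iN)) iotaD find_cat size_iota.
have -> : has a (iota 0 i) = false.
  apply/hasP => -[t]; rewrite mem_iota /= => ti at_.
  by move: (amin t ti); rewrite at_.
by case: (N - i) (subn_gt0 i N) => [|d] /=; rewrite ?iN // add0n ai addn0.
Qed.

Lemma mem_zip (T U : eqType) (A : seq T) (B : seq U) p :
  p \in zip A B -> (p.1 \in A) && (p.2 \in B).
Proof.
elim: A B => [|a A IH] [|b B] //=; rewrite !inE => /orP[/eqP->|/IH/andP[-> ->]].
  by rewrite !eqxx.
by rewrite !orbT.
Qed.

Lemma zip_uniq_fst (T U : eqType) (A : seq T) (B : seq U) : uniq A -> uniq (zip A B).
Proof.
elim: A B => [|a A IH] [|b B] //= /andP[aA uA]; rewrite IH // andbT.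
by apply: contra aA => /mem_zip/andP[].
Qed.

Lemma zip_fst_inj (T U : eqType) (A : seq T) (B : seq U) p p' :
  uniq A -> p \in zip A B -> p' \in zip A B -> p.1 = p'.1 -> p = p'.
Proof.
elim: A B => [|a A IH] [|b B] //= /andP[aA uA].
have fst_mem z : z \in zip A B -> z.1 \in A by move/mem_zip/andP=> [].
rewrite !inE => /orP[/eqP->|pz] /orP[/eqP->|p'z] //=.
- by move=> ae; move: aA; rewrite ae (fst_mem _ p'z).
- by move=> ae; move: aA; rewrite -ae (fst_mem _ pz).
- by move=> ae; apply: IH uA pz p'z ae.
Qed.

Lemma zip_snd_inj (T U : eqType) (A : seq T) (B : seq U) p p' :
  uniq B -> p \in zip A B -> p' \in zip A B -> p.2 = p'.2 -> p = p'.
Proof.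
elim: A B => [|a A IH] [|b B] //= /andP[bB uB].
have snd_mem z : z \in zip A B -> z.2 \in B by move/mem_zip/andP=> [].
rewrite !inE => /orP[/eqP->|pz] /orP[/eqP->|p'z] //=.
- by move=> be; move: bB; rewrite be (snd_mem _ p'z).
- by move=> be; move: bB; rewrite -be (snd_mem _ pz).
- by move=> be; apply: IH uB pz p'z be.
Qed.

(** When a parity block becomes full, it and its index block leave their lists of live blocks
    together. This keeps the correspondence by rank intact for all the other pairs. *)
Lemma zip_filter_neq (T U : eqType) (A : seq T) (B : seq U) a b :
  size A = size B -> uniq A -> uniq B -> (a, b) \in zip A B ->
  zip [seq x <- A | x != a] [seq y <- B | y != b]
    = [seq p <- zip A B | p != (a, b)]
  /\ size [seq x <- A | x != a] = size [seq y <- B | y != b].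
Proof.
elim: A B => [|a0 A IH] [|b0 B] //= [sAB] /andP[aA uA] /andP[bB uB].
rewrite inE => /orP[/eqP[ea eb]|pz].
  subst a0 b0; rewrite !eqxx /=.
  have fA : [seq x <- A | x != a] = A.
    by apply/all_filterP/allP => x xA; apply: contraNneq aA => <-.
  have fB : [seq x <- B | x != b] = B.
    by apply/all_filterP/allP => x xB; apply: contraNneq bB => <-.
  rewrite fA fB; split=> //; apply/esym/all_filterP/allP => -[x y] /mem_zip /=.
  by case/andP => xA _; apply: contraNneq aA => -[<-].
have /andP[aA' bB'] := mem_zip pz.
have na : a0 != a by apply: contraNneq aA => ->.
have nb : b0 != b by apply: contraNneq bB => ->.
rewrite na nb xpair_eqE (negPf na) /=.
by have [-> ->] := IH _ sAB uA uB pz.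
Qed.

(** Only [2 * b] and [2 * b + 1] have quotient [b] by 2. It serves to count live half blocks by the
    live blocks that contain them. *)
Lemma size_filter_iota_halve (P R : pred nat) N :
  (forall b, P b -> R (b %/ 2)) ->
  size [seq b <- iota 0 (2 * N) | P b] <= 2 * size [seq b <- iota 0 N | R b].
Proof.
move=> PR; elim: N => [//|N IH].
have -> : 2 * N.+1 = 2 * N + 2 by lia.
rewrite iotaD -[N.+1]addn1 iotaD !filter_cat !size_cat mulnDr leq_add //=.
have := PR (2 * N); have := PR (2 * N).+1.
have -> : (2 * N).+1 %/ 2 = N by lia.
have -> : (2 * N) %/ 2 = N by lia.
rewrite !add0n /=.
case: (R N); case: (P (2 * N).+1); case: (P (2 * N)) => //= h1 h2.
- by have := h1 isT.
- by have := h1 isT.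
- by have := h2 isT.
Qed.

Lemma binary_sum mu a :
  a < 2 ^ mu -> \sum_(t < mu) 2 ^ t * odd (a %/ 2 ^ t) = a.
Proof.
elim: mu a => [|mu IH] a amu; first by rewrite big_ord0; case: a amu.
rewrite big_ord_recl /= expn0 divn1 mul1n.
under eq_bigr => t _ do rewrite /bump /= add1n expnS divnMA -mulnA.
rewrite -big_distrr /= IH; last by rewrite ltn_divLR // mulnC -expnS.
by have := divn_eq a 2; rewrite modn2; lia.
Qed.

(** All [mu] binary digits of [2 ^ mu - 1] are 1. Hence writing [max_index] puts every cell of an
    index block on its upper level. *)
Lemma odd_pred_exp2_div mu t : t < mu -> odd ((2 ^ mu).-1 %/ 2 ^ t).
Proof.
move=> tmu; have -> : (2 ^ mu).-1 = (2 ^ (mu - t)).-1 * 2 ^ t + (2 ^ t).-1.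
  by rewrite -{1}(subnK (ltnW tmu)) expnD; have := expn_gt0 2 t; have := expn_gt0 2 (mu - t); nia.
rewrite divnMDl ?expn_gt0 // divn_small ?prednK ?expn_gt0 // addn0.
rewrite -(subnSK tmu) expnS; case: (2 ^ _) (expn_gt0 2 (mu - t.+1)) => // a _.
by rewrite mulnS /= oddM.
Qed.

Lemma card_ord_interval n a b :
  b <= n -> #|[set j : 'I_n | a <= j < b]| = b - a.
Proof.
move=> bn; rewrite -sum1_card.
rewrite (eq_bigl (fun j : 'I_n => a <= j < b)); last by move=> j; rewrite inE.
rewrite -(big_mkord (fun j => (a <= j) && (j < b)) (fun=> 1)).
rewrite -(big_nat_widen 0 b n (fun j => a <= j)) //.
rewrite -(big_nat_widenl a 0 b xpredT) //.
by rewrite sum_nat_const_nat muln1.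
Qed.

End Sequences.

(** * Setting of the construction, and the geometry of parity blocks *)

Section Construction.

Variables (s q n : nat) (pick : cell_choice q n).
Hypotheses (s_gt0 : 0 < s) (q_gt1 : 1 < q) (pickP : valid_choice pick).

Local Notation K := (2 ^ s).
Local Notation ni := (n_index_cells s q).
Local Notation nb := (n_index_blocks s).
Local Notation M := (m s q n).
Local Notation bs := (block_size s).
Local Notation blk := (block s q n).
Local Notation iv := (index_value s).

Implicit Types (x y : state q n) (v : bits K) (A : {set 'I_n}) (r b u a : nat).

Lemma cell_le x j : x j <= q.-1.
Proof. by rewrite -ltnS ltn_ord. Qed.

Lemma K_gt1 : 1 < K.
Proof. by rewrite -(expn0 2) ltn_exp2l. Qed.

(** The choice of [mu'] gives [K + 2 <= 2 ^ mu']. So the [K + 1] values 0, ..., K of a live index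
    block all differ from the maximal one, which marks a dead block. *)
Lemma max_index_gt : K < max_index s.
Proof.
have := @up_logP 2 (K + 2) isT; rewrite -/(mu' s) /max_index; lia.
Qed.

Lemma block_sizeE r : r <= s -> bs r = 2 ^ (s - r).
Proof. by move=> rs; rewrite /block_size -{1}(subnK rs) expnD mulnK ?expn_gt0. Qed.

Lemma block_size_gt0 r : r <= s -> 0 < bs r.
Proof. by move=> rs; rewrite block_sizeE ?expn_gt0. Qed.

Lemma block_sizeS r : r < s -> bs r = bs r.+1 * 2.
Proof. by move=> rs; rewrite !block_sizeE ?(ltnW rs) // -expnSr subnSK. Qed.

Lemma block_size_mul r : r <= s -> 2 ^ r * bs r = K.
Proof. by move=> rs; rewrite block_sizeE // -expnD subnKC. Qed.

Lemma m_le : 0 < M -> ni + M * K <= n.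
Proof.
have := leq_trunc_div (n - ni) K; rewrite -/M => h M0.
have : 0 < M * K by rewrite muln_gt0 M0 expn_gt0.
lia.
Qed.

(** In this form the block number of a data cell is a quotient, so that disjointness and refinement
    of blocks become facts about division. *)
Lemma mem_block r b (j : 'I_n) :
  r <= s -> (j \in blk r b) = (ni <= j) && ((j - ni) %/ bs r == b).
Proof.
move=> /block_size_gt0 d0; rewrite inE /position eqn_leq andbC.
rewrite leq_divRL // -[_ %/ _ <= b]ltnS ltn_divLR // mulSn; lia.
Qed.

Lemma block_inj r b b' (j : 'I_n) :
  r <= s -> j \in blk r b -> j \in blk r b' -> b = b'.
Proof. by move=> rs; rewrite !mem_block // => /andP[_ /eqP<-] /andP[_ /eqP]. Qed.

Lemma block_position r b t :
  r <= s -> b < 2 ^ r * M -> t <= bs r -> position s q r b t <= ni + M * K /\ ni + M * K <= n.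
Proof.
move=> rs bM tb; split; last by apply: m_le; case: (M) bM => //; rewrite muln0.
rewrite /position -addnA leq_add2l -(block_size_mul rs) mulnA [M * _]mulnC.
by apply: (leq_trans (n := b.+1 * bs r)); rewrite ?leq_mul2r ?bM ?orbT // mulSn addnC leq_add2r.
Qed.

Lemma card_block r b : r <= s -> b < 2 ^ r * M -> #|blk r b| = bs r.
Proof.
move=> rs bM; have [h1 h2] := block_position rs bM (leqnn _).
rewrite card_ord_interval ?(leq_trans h1) // /position; lia.
Qed.

Lemma sum_full x A : full x A -> \sum_(j in A) x j = #|A| * q.-1.
Proof.
move=> /forall_inP fx; rewrite -sum_nat_const.
by apply: eq_bigr => j jA; apply/eqP/fx.
Qed.

(** For [r < s] a block has an even number of cells, so its total when full is even whatever [q]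
    is. *)
Lemma parity_full x r b :
  r < s -> b < 2 ^ r * M -> full x (blk r b) -> parity x (blk r b) = false.
Proof.
move=> rs bM /sum_full; rewrite /parity => ->.
by rewrite card_block // 1?ltnW // block_sizeS // !oddM andbF.
Qed.

Lemma not_fullP x A : reflect (exists2 j, j \in A & x j < q.-1) (~~ full x A).
Proof.
rewrite /full; apply: (iffP forall_inPn) => -[j jA h]; exists j => //.
  by rewrite ltn_neqAle h cell_le.
by rewrite neq_ltn h.
Qed.

Lemma full_eq x y A :
  {in A, forall j, x j = y j :> nat} -> full x A = full y A.
Proof. by move=> xy; apply: eq_forallb_in => j jA; rewrite xy. Qed.

Lemma parity_eq x y A :
  {in A, forall j, x j = y j :> nat} -> parity x A = parity y A.
Proof. by move=> xy; congr odd; apply: eq_bigr. Qed.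

Lemma block_refine r b (j : 'I_n) :
  r < s -> j \in blk r.+1 b -> j \in blk r (b %/ 2).
Proof.
move=> rs; rewrite (mem_block b j rs) (mem_block _ j (ltnW rs)) => /andP[-> /eqP<-].
by rewrite -divnMA -block_sizeS // eqxx.
Qed.

Lemma size_live_blocks_refine r x :
  r < s -> size (live_blocks s r.+1 x) <= 2 * size (live_blocks s r x).
Proof.
move=> rs; rewrite /live_blocks expnS -mulnA.
apply: (@size_filter_iota_halve (fun b => ~~ full x (blk r.+1 b))
          (fun b => ~~ full x (blk r b))) => b /not_fullP[j jb xj].
by apply/not_fullP; exists j => //; apply: block_refine.
Qed.

(** * Order on states, the sum of the data levels, and the effect of raising one cell *)

Definition le_state x y := forall j, x j <= y j.

Definition data_sum x := \sum_(j : 'I_n | ni <= j) x j.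

Lemma le_state_trans y x z : le_state x y -> le_state y z -> le_state x z.
Proof. by move=> xy yz j; apply: leq_trans (xy j) (yz j). Qed.

Lemma inord_le i : i <= q.-1 -> (inord i : 'I_q.-1.+1) = i :> nat.
Proof. by move=> iq; rewrite inordK. Qed.

Lemma raiseE x (i : 'I_n) : x i < q.-1 -> forall j, raise x i j = x j + (j == i) :> nat.
Proof.
move=> xi j; rewrite ffunE -val_eqE /=; case: eqVneq => [/ord_inj->|_].
  by rewrite inord_le // addn1.
by rewrite addn0.
Qed.

Lemma incrementE x A : ~~ full x A ->
  exists c, [/\ c \in A, x c < q.-1
             & forall j, increment pick x A j = x j + (j == c) :> nat].
Proof.
move=> /not_fullP/pickP[cA xc]; exists (pick x A); split=> //.
exact: raiseE.
Qed.

Lemma data_sum_eq x y :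
  (forall j : 'I_n, ni <= j -> x j = y j :> nat) -> data_sum x = data_sum y.
Proof. by move=> xy; apply: eq_bigr. Qed.

Lemma data_sum_incr x y (c : 'I_n) :
  ni <= c -> (forall j : 'I_n, ni <= j -> y j = x j + (j == c) :> nat) ->
  data_sum y = (data_sum x).+1.
Proof.
move=> cni yx; rewrite /data_sum (eq_bigr (fun j => x j + (j == c))) //.
rewrite big_split /= -[RHS]addn1; congr (_ + _).
by rewrite (bigD1 c) //= eqxx big1 ?addn0 // => j /andP[_ /negPf->].
Qed.

Lemma block_data r b (j : 'I_n) : r <= s -> j \in blk r b -> ni <= j.
Proof. by move=> rs; rewrite mem_block // => /andP[]. Qed.

Lemma live_blocks_eq r x y : r <= s ->
  (forall j : 'I_n, ni <= j -> x j = y j :> nat) ->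
  live_blocks s r x = live_blocks s r y.
Proof.
move=> rs xy; apply: eq_filter => b; congr (~~ _).
by apply: full_eq => j /(block_data rs)/xy.
Qed.

Lemma level_ord x (j : 'I_n) : level x j = x j.
Proof. by rewrite /level valK. Qed.

Lemma level_out x p : n <= p -> level x p = 0.
Proof. by move=> np; rewrite /level insubN // -leqNgt. Qed.

Lemma levelP x y p :
  (forall j : 'I_n, j = p :> nat -> x j = y j :> nat) -> level x p = level y p.
Proof.
move=> xy; case: (ltnP p n) => [pn|np]; last by rewrite !level_out.
by rewrite -[p]/(val (Ordinal pn)) !level_ord xy.
Qed.

(** * Index cells: stacked levels, reading and writing numbers *)

Lemma base_lt r : base q r < q.-1.
Proof. by rewrite ltn_pmod //; lia. Qed.

(** Stage [r] uses the set of cells with number [(r - 1) %/ (q - 1)]. For [r < s] this is below the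
    ceiling of [(s - 1) / (q - 1)], the number of sets put aside. *)
Lemma in_batch_ni r p : 0 < r < s -> in_batch s q r p -> p < ni.
Proof.
move=> /andP[r0 rs] /andP[_]; rewrite /first_cell -mulSnr => ps.
apply: leq_trans ps _; rewrite leq_mul2r /ceil_div; apply/orP; right.
have Q0 : 0 < q.-1 by lia.
rewrite leq_divRL // mulSn.
have := leq_trunc_div r.-1 q.-1; lia.
Qed.

Lemma index_position_batch r u t :
  u < nb -> t < mu' s -> in_batch s q r (index_position s q r u t).
Proof.
move=> unb tmu; rewrite /in_batch /index_position /index_set_size.
have : u.+1 * mu' s <= nb * mu' s by rewrite leq_mul2r unb orbT.
rewrite mulSn; lia.
Qed.

Lemma level_set_index r u a x p : p < n ->
  level (set_index s r x u a) p =
    if index_position s q r u 0 <= p < index_position s q r u (mu' s)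
    then base q r + odd (a %/ 2 ^ (p - index_position s q r u 0)) else level x p.
Proof.
move=> pn; rewrite -[p]/(val (Ordinal pn)) !level_ord ffunE /=.
case: ifP => // _; rewrite inord_le //.
by have := base_lt r; case: odd => /=; lia.
Qed.

Lemma index_value_eq r x y u :
  (forall t, t < mu' s -> level x (index_position s q r u t)
                        = level y (index_position s q r u t)) ->
  iv r x u = iv r y u.
Proof. by move=> xy; apply: eq_bigr => t _; rewrite xy. Qed.

(** The bound [ni <= n] ensures that all cells of the index block exist; a missing cell would be
    read as level 0 and lose its digit. *)
Lemma index_value_same r x u a :
  0 < r < s -> ni <= n -> u < nb -> a <= max_index s ->
  iv r (set_index s r x u a) u = a.
Proof.
move=> rs nin unb amax; rewrite /index_value.
have amu : a < 2 ^ mu' s by rewrite -(prednK (n := 2 ^ mu' s)) ?expn_gt0.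
rewrite -[RHS](binary_sum amu); apply: eq_bigr => t _.
have pn : index_position s q r u t < n.
  by apply: leq_trans nin; apply: in_batch_ni rs _; apply: index_position_batch.
rewrite level_set_index // /index_position addn0 leq_addr ltn_add2l ltn_ord /=.
by rewrite addKn; case: odd; rewrite ?addn0 ?ltnn // addn1 ltnSn.
Qed.

Lemma index_value_other r x u u' a :
  0 < r < s -> u != u' -> iv r (set_index s r x u a) u' = iv r x u'.
Proof.
move=> rs uu'; apply: index_value_eq => t tmu.
apply: levelP => j jp; rewrite ffunE; case: ifP => //.
rewrite jp /index_position addn0 -!addnA !leq_add2l ltn_add2l.
move=> /andP[h1 h2]; move: uu'; rewrite neq_ltn => /orP[] lt.
  by have : u.+1 * mu' s <= u' * mu' s by [rewrite leq_mul2r lt orbT]; rewrite mulSn; lia.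
by have : u'.+1 * mu' s <= u * mu' s by [rewrite leq_mul2r lt orbT]; rewrite mulSn; lia.
Qed.

Lemma index_position_range r u p :
  index_position s q r u 0 <= p < index_position s q r u (mu' s) ->
  exists2 t, t < mu' s & p = index_position s q r u t.
Proof.
by move=> h; exists (p - index_position s q r u 0); move: h; rewrite /index_position; lia.
Qed.

Lemma set_index_data r x u a (j : 'I_n) :
  u < nb -> ~~ in_batch s q r j -> set_index s r x u a j = x j.
Proof.
move=> unb nj; rewrite ffunE; case: ifP => // /index_position_range[t tmu jt].
by case/negP: nj; rewrite jt index_position_batch.
Qed.

Lemma set_index_le r x u a :
  (forall t, t < mu' s ->
     level x (index_position s q r u t) <= base q r + odd (a %/ 2 ^ t)) ->
  le_state x (set_index s r x u a).
Proof.
move=> xa j; rewrite ffunE; case: ifP => // /index_position_range[t tmu jt].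
have := xa t tmu; rewrite -jt level_ord inord_le; last first.
  by have := base_lt r; case: odd => /=; lia.
by rewrite jt /index_position addn0 addKn.
Qed.

Lemma set_index_in r x u a (j : 'I_n) :
  in_batch s q r j -> base q r <= x j <= (base q r).+1 ->
  base q r <= set_index s r x u a j <= (base q r).+1.
Proof.
move=> ib xj; rewrite ffunE; case: ifP => // _; rewrite inord_le.
  by case: odd => /=; lia.
by have := base_lt r; case: odd => /=; lia.
Qed.

(** Index cells during stage [r]: those of its own batch are on one of its two levels, and the sets
    reserved for later batches are still untouched. Earlier sets are left unconstrained. *)
Definition index_ok r x :=
  (forall j : 'I_n, in_batch s q r j -> base q r <= x j <= (base q r).+1) /\
  (forall j : 'I_n, first_cell s q r + index_set_size s <= j < ni -> x j = 0 :> nat).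

Lemma index_ok_set r x u a :
  0 < r < s -> u < nb -> index_ok r x -> index_ok r (set_index s r x u a).
Proof.
move=> rs unb [ib later]; split=> j hj; first exact/set_index_in/ib.
by rewrite set_index_data ?later // /in_batch; lia.
Qed.

Lemma index_ok_eq r x y : 0 < r < s ->
  (forall j : 'I_n, j < ni -> x j = y j :> nat) -> index_ok r x -> index_ok r y.
Proof.
move=> rs xy [ib later]; split=> j hj; rewrite -xy ?ib ?later //.
  exact: in_batch_ni hj.
by case/andP: hj.
Qed.

Lemma index_value_data r x y u : 0 < r < s -> u < nb ->
  (forall j : 'I_n, j < ni -> x j = y j :> nat) -> iv r x u = iv r y u.
Proof.
move=> rs unb xy; apply: index_value_eq => t tmu; apply: levelP => j jp.
by apply: xy; rewrite jp; apply: in_batch_ni rs _; apply: index_position_batch.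
Qed.

Lemma index_value0 r x u t : iv r x u = 0 -> t < mu' s ->
  level x (index_position s q r u t) <= base q r.
Proof.
move=> /eqP; rewrite sum_nat_eq0 => /forallP iv0 tmu.
have := iv0 (Ordinal tmu); rewrite /= muln_eq0 -leqn0 leqNgt expn_gt0 /=.
by rewrite eqb0 -leqNgt.
Qed.

(** * Invariant and decoding of an indexed stage *)

(** Equal sizes mean that [zip] drops no live block from [live_pairs]. Injectivity on nonzero values
    means that a bit is represented by at most one live pair; the value 0 may be shared. *)
Record good r x : Prop := Good {
  good_index : index_ok r x;
  good_size : size (live_indices s r x) = size (live_blocks s r x);
  good_inj : {in live_indices s r x &, forall u u',
    iv r x u = iv r x u' -> iv r x u != 0 -> u = u'};
  good_le : {in live_indices s r x, forall u, iv r x u <= K} }.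

(** An order-free form of the decoded bit; it is false by default when no live pair carries the
    index [l + 1]. *)
Definition bit_value r x l :=
  has (fun p => (iv r x p.1 == l.+1) && parity x (blk r p.2)) (live_pairs s r x).

Lemma live_pairs_mem r x p : p \in live_pairs s r x ->
  [/\ p.1 \in live_indices s r x, p.1 < nb, iv r x p.1 != max_index s,
      p.2 < 2 ^ r * M & ~~ full x (blk r p.2)].
Proof.
move=> /mem_zip/andP[li]; rewrite mem_filter mem_iota => /andP[-> /andP[_ ->]].
by move: (li); rewrite mem_filter mem_iota => /andP[-> /andP[_ ->]].
Qed.

Lemma live_indices_uniq r x : uniq (live_indices s r x).
Proof. by rewrite filter_uniq ?iota_uniq. Qed.

Lemma live_blocks_uniq r x : uniq (live_blocks s r x).
Proof. by rewrite filter_uniq ?iota_uniq. Qed.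

Lemma live_pairs_inj r x : good r x -> {in live_pairs s r x &, forall p p',
  iv r x p.1 = iv r x p'.1 -> iv r x p.1 != 0 -> p = p'}.
Proof.
move=> gx p p' px p'x ivpp' ivp.
apply: (zip_fst_inj (live_indices_uniq r x) px p'x).
have [li _ _ _ _] := live_pairs_mem px; have [li' _ _ _ _] := live_pairs_mem p'x.
exact: good_inj gx _ _ li li' ivpp' ivp.
Qed.

Lemma bit_value_at r x p l : good r x -> p \in live_pairs s r x ->
  iv r x p.1 = l.+1 -> bit_value r x l = parity x (blk r p.2).
Proof.
move=> gx px ivp; apply/hasP/idP => [[p' p'x /andP[/eqP ivp' par]]|par].
  by rewrite (live_pairs_inj gx px p'x) ?ivp ?ivp'.
by exists p; rewrite ?ivp ?eqxx.
Qed.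

(** By injectivity at most one element of the list writes to a given bit, so later writes of the
    fold never override earlier ones. The value 0 of [f] stands for no bit. *)
Lemma foldl_set_bit (T : eqType) (f : T -> nat) (g : T -> bool) (P : seq T) v (l : 'I_K) :
  uniq P -> {in P &, forall p p', f p = f p' -> f p != 0 -> p = p'} ->
  foldl (fun v p => if f p is i.+1 then set_bit v i (g p) else v) v P l
  = if has (fun p => f p == l.+1) P then has (fun p => (f p == l.+1) && g p) P
    else v l.
Proof.
elim: P v => [//|p P IH] v /= /andP[pP uP] inj.
rewrite IH //; last by move=> a b aP bP; apply: inj; rewrite inE ?aP ?bP orbT.
have [fp|fp] := eqVneq (f p) l.+1; last first.
  rewrite /=; case: ifP => // _; case: (f p) fp => // i; rewrite eqSS ffunE.
  by rewrite eq_sym => /negPf->.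
have nh : has (fun p => f p == l.+1) P = false.
  apply/hasP => -[p' p'P /eqP fp'].
  have pp' : p = p' by apply: inj; rewrite ?inE ?eqxx ?p'P ?orbT // fp ?fp'.
  by move: pP; rewrite pp' p'P.
have -> : has (fun p => (f p == l.+1) && g p) P = false.
  by apply/hasP => -[p' p'P /andP[fp' _]]; case/hasP: nh; exists p'.
by rewrite nh fp ffunE !eqxx /= orbF.
Qed.

Lemma decode_indexedE r x (l : 'I_K) :
  good r x -> decode_indexed s r x l = bit_value r x l.
Proof.
move=> gx; rewrite /decode_indexed foldl_set_bit; last first.
- exact: live_pairs_inj.
- exact/zip_uniq_fst/live_indices_uniq.
rewrite ffunE; case: ifP => // /negbT nh; apply/esym/negbTE; apply: contra nh.
by move=> /hasP[p px /andP[h _]]; apply/hasP; exists p.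
Qed.

Lemma started_le r x y : le_state x y -> started s r x -> started s r y.
Proof.
move=> xy /existsP[j /andP[jb bx]]; apply/existsP; exists j.
by rewrite jb (leq_trans bx).
Qed.

Lemma live_pairs_data r x p : p \in live_pairs s r x -> ni <= n.
Proof.
move=> /live_pairs_mem[_ _ _ bM _]; have := @m_le.
by case: (M) bM => [|M']; rewrite ?muln0 // => _ /(_ isT); lia.
Qed.

(** * Writes in an indexed stage, and what is left when such a stage stops *)

Lemma good_shrink r x y : index_ok r y ->
  size (live_indices s r y) = size (live_blocks s r y) ->
  {subset live_indices s r y <= live_indices s r x} ->
  {in live_indices s r y, forall u, iv r y u = iv r x u} ->
  good r x -> good r y.
Proof.
move=> oky sz sub ivxy gx; split=> //.
  move=> u u' uy u'y; rewrite !ivxy //.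
  by apply: (good_inj gx); apply: sub.
by move=> u uy; rewrite ivxy //; apply: (good_le gx); apply: sub.
Qed.

(** Either the block stays live and the list of pairs is unchanged, or it becomes full and exactly
    [p] leaves the list. In the second case the parity before was odd, since one more level gives a
    full block, whose parity is even. *)
Lemma increment_pair_step r x p (y := increment_pair s pick r x p) :
  0 < r < s -> good r x -> p \in live_pairs s r x ->
  [/\ good r y, le_state x y & data_sum y = (data_sum x).+1] /\
  [/\ {subset live_pairs s r y <= live_pairs s r x},
      {in live_pairs s r x, forall p', p' != p -> p' \in live_pairs s r y},
      {in live_pairs s r y, forall p', iv r y p'.1 = iv r x p'.1},
      {in live_pairs s r x, forall p', p' != p ->
         parity y (blk r p'.2) = parity x (blk r p'.2)} &
      (p \in live_pairs s r y -> parity y (blk r p.2) = ~~ parity x (blk r p.2)) /\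
      (p \notin live_pairs s r y -> parity x (blk r p.2))].
Proof.
move=> rs gx px; have nin := live_pairs_data px.
have rs' : r <= s by lia.
have [ux unb ivp bM nfull] := live_pairs_mem px.
have [c [cb xc yE]] := incrementE nfull.
set y0 := increment pick x (blk r p.2) in yE.
have cni : ni <= c := block_data rs' cb.
have y0x (j : 'I_n) : j < ni -> x j = y0 j :> nat.
  move=> jni; rewrite yE; case: eqVneq => [jc|]; last by rewrite addn0.
  by move: jni; rewrite jc ltnNge cni.
have ok0 : index_ok r y0 by apply: index_ok_eq (good_index gx).
have iv0 u : u < nb -> iv r y0 u = iv r x u.
  by move=> h; apply/esym/index_value_data.
have other b : b != p.2 -> {in blk r b, forall j, y0 j = x j :> nat}.
  move=> bp j jb; rewrite yE; case: eqVneq => [jc|]; last by rewrite addn0.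
  by case/eqP: bp; apply: block_inj rs' jb _; rewrite jc.
have par0 : parity y0 (blk r p.2) = ~~ parity x (blk r p.2).
  rewrite /parity (eq_bigr (fun j => x j + (j == c))) // big_split /= oddD addbC.
  rewrite (bigD1 c) //= eqxx big1 ?addn0 //= => j /andP[_ /negPf->] //.
have sum0 : data_sum y0 = (data_sum x).+1 by apply: (data_sum_incr cni).
have le0 : le_state x y0 by move=> j; rewrite yE leq_addr.
have fst_inj p' : p' \in live_pairs s r x -> p'.1 = p.1 -> p' = p.
  by move=> p'x; apply: zip_fst_inj p'x px; apply: live_indices_uniq.
have snd_ne p' : p' \in live_pairs s r x -> p' != p -> p'.2 != p.2.
  move=> p'x; apply: contra => /eqP; move/(zip_snd_inj (live_blocks_uniq r x) p'x px)=> ->.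
  by rewrite eqxx.
rewrite {}/y /increment_pair -/y0; case: ifPn => full0; last first.
  have li0 : live_indices s r y0 = live_indices s r x.
    by apply: eq_in_filter => u; rewrite mem_iota => /andP[_ ?]; rewrite iv0.
  have lb0 : live_blocks s r y0 = live_blocks s r x.
    apply: eq_filter => b; case: (eqVneq b p.2) => [->|bp]; first by rewrite full0 nfull.
    by rewrite (full_eq (other b bp)).
  have lp0 : live_pairs s r y0 = live_pairs s r x by rewrite /live_pairs li0 lb0.
  split; first split=> //.
    apply: (good_shrink ok0 _ _ _ gx).
    - by rewrite li0 lb0 (good_size gx).
    - by move=> u; rewrite li0.
    by move=> u; rewrite mem_filter mem_iota => /andP[_ /andP[_ ?]]; rewrite iv0.
  rewrite lp0; split=> //.
  - by move=> p' /live_pairs_mem[_ ? _ _ _]; rewrite iv0.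
  - by move=> p' p'x pp'; apply/parity_eq/other/snd_ne.
  - by rewrite px.
(* The block has become full: relative to [y0] only index cells change, so all statements about data
   cells carry over. *)
set y := set_index _ _ _ _ _.
have yy0 (j : 'I_n) : ni <= j -> y j = y0 j :> nat.
  move=> jni; rewrite set_index_data //; apply/negP => /(in_batch_ni rs).
  by rewrite ltnNge jni.
have ivy u : u < nb -> iv r y u = if u == p.1 then max_index s else iv r x u.
  move=> h; case: eqVneq => [->|up]; first by rewrite index_value_same.
  by rewrite index_value_other 1?eq_sym ?iv0.
have li1 : live_indices s r y = [seq u <- live_indices s r x | u != p.1].
  rewrite -filter_predI; apply: eq_in_filter => u; rewrite mem_iota => /andP[_ unb'].
  by rewrite ivy //=; case: (u == p.1); rewrite ?eqxx.
have lb1 : live_blocks s r y = [seq b <- live_blocks s r x | b != p.2].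
  rewrite (live_blocks_eq rs' yy0) -filter_predI; apply: eq_filter => b /=.
  case: (eqVneq b p.2) => [->|bp] /=; first by rewrite full0.
  by rewrite (full_eq (other b bp)).
have pE : p = (p.1, p.2) by case: (p).
have [lp1 sz1] := zip_filter_neq (good_size gx) (live_indices_uniq r x)
                    (live_blocks_uniq r x) (etrans (congr1 _ (esym pE)) px).
have {}lp1 : live_pairs s r y = [seq p' <- live_pairs s r x | p' != p].
  by rewrite [LHS]/live_pairs li1 lb1 lp1 -pE.
have parx : parity x (blk r p.2).
  apply: negbNE; rewrite -par0 parity_full //; lia.
split; first split.
- apply: good_shrink gx; rewrite ?li1 ?lb1 //.
  + exact: index_ok_set.
  + by move=> u; rewrite mem_filter => /andP[].
  move=> u; rewrite mem_filter => /andP[up]; rewrite mem_filter mem_iota.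
  by move=> /andP[_ /andP[_ ?]]; rewrite ivy // (negPf up).
- move=> j; apply: leq_trans (le0 j) _; apply: set_index_le => t tmu.
  rewrite odd_pred_exp2_div // addn1.
  have ib := index_position_batch r unb tmu.
  have pn := leq_trans (in_batch_ni rs ib) nin.
  rewrite -[index_position _ _ _ _ _]/(val (Ordinal pn)) level_ord.
  by case/andP: (ok0.1 (Ordinal pn) ib).
- by rewrite -sum0; apply: data_sum_eq.
rewrite lp1; split.
- by move=> p'; rewrite mem_filter => /andP[].
- by move=> p' p'x pp'; rewrite mem_filter pp'.
- move=> p'; rewrite mem_filter => /andP[pp' p'x].
  have [_ ? _ _ _] := live_pairs_mem p'x; rewrite ivy //.
  by case: eqVneq => // /(fst_inj _ p'x)/eqP; rewrite (negPf pp').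
- move=> p' p'x pp'; rewrite -(parity_eq (other _ (snd_ne _ p'x pp'))).
  by apply: parity_eq => j jb; apply: yy0; apply: block_data jb.
- by rewrite mem_filter eqxx.
Qed.
(** If the pair survives, the parity of its block has flipped. If not, no live pair carries [i + 1]
    any more and the bit falls to its default 0, while the block was odd before, so the bit is
    flipped as well. *)
Lemma increment_pair_bits r x p i (y := increment_pair s pick r x p) :
  0 < r < s -> good r x -> p \in live_pairs s r x -> iv r x p.1 = i.+1 ->
  forall l, bit_value r y l = bit_value r x l (+) (l == i).
Proof.
move=> rs gx px ivp l.
have [[gy _ _] [sub keep ivy pary [py npy]]] := increment_pair_step rs gx px.
have [->|li] := eqVneq l i.
  rewrite addbT (bit_value_at gx px ivp).
  have [py'|npy'] := boolP (p \in live_pairs s r y).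
    by rewrite (bit_value_at gy py') ?ivy ?py.
  rewrite npy //; apply/hasP => -[p' p'y /andP[/eqP ivp' _]].
  move: npy'; rewrite (live_pairs_inj gx px (sub _ p'y)) ?p'y ?ivp //.
  by rewrite -ivy // ivp'.
have ne p' : p' \in live_pairs s r x -> iv r x p'.1 = l.+1 -> p' != p.
  move=> _ ivp'; apply/eqP => pp'; move: ivp'; rewrite pp' ivp => -[il].
  by rewrite il eqxx in li.
rewrite addbF; apply/hasP/hasP => -[p' hp' /andP[/eqP ivp' par]]; exists p'.
- exact: sub.
- have px' := sub _ hp'; rewrite ivy // in ivp'.
  by rewrite ivp' eqxx -pary ?ne.
- by rewrite keep ?ne.
- by rewrite ivy ?keep ?ne // ivp' eqxx pary ?ne.
Qed.

(** A block of value 0 has all its cells at or below the lower level, so writing [a] lowers none of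
    them. As [a <= K] the index block stays live, and as no live index block holds [a] yet,
    injectivity is kept. *)
Lemma set_live_index r x u a (y := set_index s r x u a) :
  0 < r < s -> ni <= n -> good r x -> u \in live_indices s r x -> iv r x u = 0 ->
  a <= K -> {in live_indices s r x, forall u', iv r x u' != a} ->
  [/\ good r y, le_state x y & forall j : 'I_n, ni <= j -> y j = x j :> nat] /\
  [/\ live_pairs s r y = live_pairs s r x,
      iv r y u = a & {in live_indices s r x, forall u', u' != u -> iv r y u' = iv r x u'}].
Proof.
move=> rs nin gx ux iv0 aK fresh_a.
have rs' : r <= s by lia.
have Kmax := max_index_gt.
have amax : a <= max_index s by lia.
have unb : u < nb by move: ux; rewrite mem_filter mem_iota => /andP[_ /andP[]].
have yE (j : 'I_n) : ni <= j -> y j = x j :> nat.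
  move=> jni; rewrite set_index_data //; apply/negP => /(in_batch_ni rs).
  by rewrite ltnNge jni.
have ivy u' : iv r y u' = if u' == u then a else iv r x u'.
  case: eqVneq => [->|uu']; first by rewrite index_value_same.
  by rewrite index_value_other // eq_sym.
have liy : live_indices s r y = live_indices s r x.
  apply: eq_filter => u'; rewrite ivy; case: (eqVneq u' u) => // ->.
  by rewrite iv0; move: Kmax aK; lia.
have lby : live_blocks s r y = live_blocks s r x by apply: live_blocks_eq.
split; last first.
  split; first by rewrite /live_pairs liy lby.
    by rewrite ivy eqxx.
  by move=> u' _ /negPf uu'; rewrite ivy uu'.
split=> //; last first.
  by apply: set_index_le => t tmu; rewrite (leq_trans (index_value0 iv0 tmu)) ?leq_addr.
split.
- exact/index_ok_set/(good_index gx).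
- by rewrite liy lby (good_size gx).
- rewrite liy => u1 u2 u1x u2x; rewrite !ivy.
  case: (eqVneq u1 u) => [->|u1u]; case: (eqVneq u2 u) => [->|u2u] //.
  + by move=> e; move: (fresh_a _ u2x); rewrite e eqxx.
  + by move=> e; move: (fresh_a _ u1x); rewrite e eqxx.
  + exact: (good_inj gx).
- by rewrite liy => u' u'x; rewrite ivy; case: ifP => // _; apply: (good_le gx).
Qed.

Lemma encode_indexed_Some r x (i : 'I_K) y :
  0 < r < s -> good r x -> encode_indexed pick r x i = Some y ->
  [/\ good r y, le_state x y, data_sum y <= (data_sum x).+1
    & forall l, bit_value r y l = bit_value r x l (+) (l == i)].
Proof.
move=> rs gx; rewrite /encode_indexed.
set P1 := [seq _ <- _ | _]; case E1 : P1 => [|p P1'].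
  set P0 := [seq _ <- _ | _]; case E0 : P0 => [//|p P0'] [<-] {y}.
  have : p \in P0 by rewrite E0 mem_head.
  rewrite mem_filter => /andP[/eqP iv0 px].
  have no_i p' : p' \in live_pairs s r x -> iv r x p'.1 != i.+1.
    move=> p'x; apply/negP => h; have : p' \in P1 by rewrite mem_filter h.
    by rewrite E1.
  (* The two lists of live blocks have equal length, so every live index block occurs in a pair. *)
  have no_iu : {in live_indices s r x, forall u, iv r x u != i.+1}.
    move=> u ux; have : u \in unzip1 (live_pairs s r x).
      by rewrite unzip1_zip // (good_size gx).
    by case/mapP => p' p'x ->; apply: no_i.
  have nin := live_pairs_data px.
  have [ux unb _ bM nfull] := live_pairs_mem px.
  have [[gy ley dy] [lpy ivy ivy']] :=
    set_live_index rs nin gx ux iv0 (ltn_ord i) no_iu.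
  set y := set_index _ _ _ _ _ in gy ley dy lpy ivy ivy' *.
  (* Bit [i] has its default value 0, so the write must turn it into 1: the block taken over has to
     end with odd parity. *)
  have bx : bit_value r x i = false.
    by apply/hasP => -[p' p'x /andP[h _]]; move: (no_i _ p'x); rewrite h.
  have py : p \in live_pairs s r y by rewrite lpy.
  have by_ (l : nat) : l != i -> bit_value r y l = bit_value r x l.
    move=> li; rewrite /bit_value lpy; apply: eq_in_has => p' p'x.
    have [u'x _ _ _ _] := live_pairs_mem p'x.
    rewrite (parity_eq (y := x)); last first.
      by move=> j jb; apply: dy; apply: block_data jb; lia.
    case: (eqVneq p'.1 p.1) => [->|pp']; last by rewrite ivy'.
    by rewrite ivy iv0 eqSS (eq_sym (i : nat) l) (negPf li).
  have sy : data_sum y = data_sum x by apply: data_sum_eq.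
  rewrite decode_indexedE // bx /=.
  have [pary|/negPn pary] := boolP (parity y (blk r p.2) != true).
    have [[gz lez sz] _] := increment_pair_step rs gy py.
    have bz := increment_pair_bits rs gy py ivy.
    split=> //; first exact: le_state_trans ley lez.
      by rewrite sz sy.
    move=> l; rewrite bz; case: (eqVneq l i) => [->|li]; last by rewrite by_.
    by rewrite bx (bit_value_at gy py ivy); case: parity pary.
  (* The block is already odd: the write costs no data level, whence the inequality on [data_sum] in
     the statement. *)
  split=> //; first by rewrite sy.
  move=> l; case: (eqVneq l i) => [->|li]; last by rewrite by_ // addbF.
  by rewrite bx (bit_value_at gy py ivy) (eqP pary).
move=> [<-].
have : p \in P1 by rewrite E1 mem_head.
rewrite mem_filter => /andP[/eqP ivp px].
have [[gy ley sy] _] := increment_pair_step rs gx px.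
split=> //; first by rewrite sy.
exact: increment_pair_bits ivp.
Qed.

(** A pigeonhole argument: the live pairs carry distinct values among 1, ..., K, none of them 0 and
    none equal to [i + 1]. *)
Lemma encode_indexed_None r x (i : 'I_K) :
  good r x -> encode_indexed pick r x i = None -> size (live_blocks s r x) < K.
Proof.
move=> gx; rewrite /encode_indexed.
set P1 := [seq _ <- _ | _]; case E1 : P1 => [|//].
set P0 := [seq _ <- _ | _]; case E0 : P0 => [|//] _.
have nz p : p \in live_pairs s r x -> iv r x p.1 != 0.
  move=> px; apply/negP => h; have : p \in P0 by rewrite mem_filter h.
  by rewrite E0.
have no_i p : p \in live_pairs s r x -> iv r x p.1 != i.+1.
  move=> px; apply/negP => h; have : p \in P1 by rewrite mem_filter h.
  by rewrite E1.
have -> : size (live_blocks s r x) = size [seq iv r x p.1 | p <- live_pairs s r x].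
  by rewrite size_map size_zip (good_size gx) minnn.
(* The removed value [i + 1] is put back in front, so that [K] becomes one more than the size of the
   list of admissible values. *)
have -> : K = size (i.+1 :: rem i.+1 (iota 1 K)).
  rewrite /= size_rem ?size_iota ?prednK ?expn_gt0 //.
  by rewrite mem_iota; have := ltn_ord i; lia.
rewrite /= ltnS; apply: uniq_leq_size.
  rewrite map_inj_in_uniq; first exact/zip_uniq_fst/live_indices_uniq.
  by move=> p p' px p'x h; apply: (live_pairs_inj gx px p'x h); apply: nz.
move=> _ /mapP[p px ->]; have [ux _ _ _ _] := live_pairs_mem px.
rewrite mem_rem_uniq ?iota_uniq // inE no_i //= mem_iota lt0n nz //= ltnS.
exact: (good_le gx).
Qed.

(** * The transition to an indexed stage *)

Definition fresh r x :=
  (forall j : 'I_n, in_batch s q r j -> x j = base q r :> nat) /\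
  (forall j : 'I_n, first_cell s q r + index_set_size s <= j < ni -> x j = 0 :> nat).

Lemma fresh_index_ok r x : fresh r x -> index_ok r x.
Proof. by move=> [ib later]; split=> // j /ib->; rewrite leqnn leqnSn. Qed.

Lemma foldl_set_index r (f : nat -> nat) us x
    (y := foldl (fun y u => set_index s r y u (f u)) x us) :
  0 < r < s -> ni <= n -> (forall u, f u <= max_index s) ->
  uniq us -> {subset us <= [pred u | u < nb]} -> index_ok r x ->
  [/\ index_ok r y,
      forall j : 'I_n, ~~ in_batch s q r j -> y j = x j
    & forall u, iv r y u = if u \in us then f u else iv r x u].
Proof.
move=> rs nin fmax; rewrite {}/y; elim: us x => [//|u us IH] x /= /andP[uus uus'] sub okx.
have unb : u < nb by apply: sub; rewrite mem_head.
have [||ok' nib ivE] := IH (set_index s r x u (f u)) uus'.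
- by move=> u' u'us; apply: sub; rewrite inE u'us orbT.
- exact: index_ok_set.
split=> //.
  by move=> j nj; rewrite nib // set_index_data.
move=> u'; rewrite ivE inE; case: (eqVneq u' u) => [->|u'u] /=.
  by rewrite (negPf uus) index_value_same.
by rewrite index_value_other // eq_sym.
Qed.

Lemma index_value_started r x u :
  0 < r < s -> u < nb -> 0 < iv r x u -> started s r x.
Proof.
move=> rs unb; rewrite lt0n sum_nat_eq0 => /forallPn[t].
rewrite /= muln_eq0 negb_or => /andP[_]; rewrite eqb0 negbK => lt.
have ib := index_position_batch r unb (ltn_ord t).
case: (ltnP (index_position s q r u t) n) => [pn|np]; last by rewrite level_out in lt.
apply/existsP; exists (Ordinal pn); rewrite /= ib /=.
by rewrite -[index_position _ _ _ _ _]/(val (Ordinal pn)) level_ord in lt.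
Qed.

(** Recording bit [i] affects only the pair of rank [i]. The pairs of the bits still to be recorded
    therefore stay live with their index values, even if the current block becomes full and drops
    out. *)
Lemma foldl_record r v L y (ls : seq 'I_K)
    (z := foldl (fun y (i : 'I_K) =>
                   let b := nth 0 L i in
                   if parity y (blk r b) != v i
                   then increment_pair s pick r y (i : nat, b) else y) y ls) :
  0 < r < s -> good r y -> uniq ls ->
  {in ls, forall i : 'I_K, (i : nat, nth 0 L i) \in live_pairs s r y /\ iv r y i = i.+1} ->
  [/\ good r z, le_state y z, data_sum z <= data_sum y + size ls
    & forall l : 'I_K, bit_value r z l = if l \in ls then v l else bit_value r y l].
Proof.
move=> rs; rewrite {}/z; elim: ls y => [|i ls IH] y gy /=.
  by move=> _ _; split=> //; rewrite ?addn0 //; move=> j.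
move=> /andP[ils uls] iy; have [piy ivi] := iy i (mem_head _ _).
set p := (_, _) in piy *.
have [paryi|paryi] := ifPn; last first.
  have [|z1 z2 z3 z4] := IH y gy uls.
    by move=> i' i'ls; apply: iy; rewrite inE i'ls orbT.
  split=> //; first by apply: leq_trans z3 _; lia.
  move=> l; rewrite z4 inE; case: (eqVneq l i) => [->|//]; rewrite (negPf ils).
  by rewrite (bit_value_at gy piy ivi) (eqP (negbNE paryi)).
set y' := increment_pair _ _ _ _ _.
have [[gy' ley' sy'] [_ keep ivy' _ _]] := increment_pair_step rs gy piy.
have by' := increment_pair_bits rs gy piy ivi.
have [|z1 z2 z3 z4] := IH y' gy' uls.
  move=> i' i'ls; have [pi'y ivi'] : _ /\ _ := iy i' (mem_behead (s := i :: ls) i'ls).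
  have pi'y' : (i' : nat, nth 0 L i') \in live_pairs s r y'.
    apply: keep => //; apply/eqP => -[ii' _].
    by move: ils; rewrite -(ord_inj ii') i'ls.
  by split=> //; rewrite -ivi'; apply: (ivy' _ pi'y').
split=> //; first exact: le_state_trans ley' z2.
  by apply: leq_trans z3 _; rewrite sy'; lia.
move=> l; rewrite z4 inE; case: (eqVneq l i) => [->|li] /=.
  rewrite (negPf ils) by' eqxx addbT (bit_value_at gy piy ivi).
  by move: paryi; rewrite /p /=; case: parity; case: (v i).
by rewrite by' (inj_eq val_inj) (negPf li) addbF.
Qed.

(** There are at most [nb] live blocks, so each gets an index block, and at least [K], so the values
    1, ..., K all go to live pairs. The first index block holds 1, which makes the stage visible to
    [started]. *)
Lemma transition_Some r v x y :
  0 < r < s -> fresh r x -> size (live_blocks s r x) <= nb ->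
  transition pick r v x = Some y ->
  [/\ good r y, started s r y, le_state x y, data_sum y <= data_sum x + K
    & forall l : 'I_K, bit_value r y l = v l].
Proof.
move=> rs frx sz; rewrite /transition; set L := live_blocks s r x in sz *.
case: ltnP => // KL [<-] {y}; have rs' : r <= s by lia.
have K1 := K_gt1; have Kmax := max_index_gt.
have nin : ni <= n.
  have : 0 < size L by lia.
  rewrite size_filter -has_count => /hasP[b]; rewrite mem_iota => /andP[_ bM] _.
  have := @m_le; case: (M) bM => [|M']; rewrite ?muln0 // => _ /(_ isT); lia.
set f := initial_index s (size L).
have fmax u : f u <= max_index s.
  by rewrite /f /initial_index; case: ifP => [|_]; [lia|case: ifP].
have subs : {subset iota 0 nb <= [pred u | u < nb]} by move=> u; rewrite mem_iota.
have [ok1 nib ivE] :=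
  foldl_set_index rs nin fmax (iota_uniq 0 nb) subs (fresh_index_ok frx).
set x1 := foldl _ x _ in ok1 nib ivE *.
have {}ivE u : u < nb -> iv r x1 u = f u by move=> h; rewrite ivE mem_iota h.
have data1 (j : 'I_n) : ni <= j -> x j = x1 j :> nat.
  move=> jni; rewrite nib //; apply/negP => /(in_batch_ni rs).
  by rewrite ltnNge jni.
have le1 : le_state x x1.
  move=> j; have [ib|/nib->//] := boolP (in_batch s q r j).
  by rewrite (frx.1 _ ib); case/andP: (ok1.1 _ ib).
have lb1 : live_blocks s r x1 = L by rewrite -(live_blocks_eq rs' data1).
(* The index blocks beyond the number of live parity blocks were made full, and no others. *)
have li1 : live_indices s r x1 = iota 0 (size L).
  rewrite /live_indices -(filter_iota_ltn 0 sz).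
  apply: eq_in_filter => u; rewrite mem_iota => /andP[_ unb]; rewrite ivE //.
  rewrite /f /initial_index add0n; case: (ltnP u K) => uK.
    by rewrite (leq_trans uK KL) neq_ltn; lia.
  by case: (ltnP u (size L)) => // uL; rewrite ?eqxx // neq_ltn; lia.
have fE u : u < size L -> f u = if u < K then u.+1 else 0.
  by rewrite /f /initial_index => ->.
have g1 : good r x1.
  split=> //.
  - by rewrite li1 lb1 size_iota.
  - rewrite li1 => u u'; rewrite !mem_iota /= !add0n => uL u'L.
    rewrite !ivE ?(leq_trans _ sz) // !fE //.
    by case: ifP => //; case: ifP => // _ _ [].
  - rewrite li1 => u; rewrite mem_iota /= add0n => uL.
    by rewrite ivE ?(leq_trans _ sz) // fE //; case: ifP.
have st1 : started s r x1.
  apply: (index_value_started rs (u := 0)).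
    by rewrite /n_index_blocks; lia.
  by rewrite ivE ?fE ?expn_gt0 // /n_index_blocks; lia.
have pairs : {in enum 'I_K, forall i : 'I_K,
    (i : nat, nth 0 L i) \in live_pairs s r x1 /\ iv r x1 i = i.+1}.
  move=> i _; have iL := leq_trans (ltn_ord i) KL; split.
    rewrite /live_pairs lb1 li1 -{1}(add0n i) -(nth_iota 0 0 iL) -nth_zip ?size_iota //.
    by apply: mem_nth; rewrite size_zip size_iota minnn.
  by rewrite ivE ?(leq_trans iL) // /f /initial_index ltn_ord.
have [z1 z2 z3 z4] := foldl_record v rs g1 (enum_uniq _) pairs.
set z := foldl _ x1 _ in z1 z2 z3 z4 *.
split=> //.
- exact: started_le st1.
- exact: le_state_trans le1 z2.
- by move: z3; rewrite size_enum_ord (data_sum_eq data1).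
- by move=> l; rewrite z4 mem_enum.
Qed.

(** If [q - 1] divides [r], stage [r + 1] opens a new set of cells, still at level 0; this includes
    the passage from stage 0 to stage 1. Otherwise it stays in the same set, one level higher, and
    closing has just raised all cells of that set to this level. *)
Lemma close_batch_step r x (y := close_batch s r x) :
  r.+1 < s -> (if r == 0 then forall j : 'I_n, j < ni -> x j = 0 :> nat else index_ok r x) ->
  [/\ fresh r.+1 y, le_state x y & forall j : 'I_n, ni <= j -> y j = x j].
Proof.
move=> rs; rewrite {}/y /close_batch; case: (eqVneq r 0) rs => [->|r0] rs.
  move=> x0; split=> //; split=> j.
    by move=> /(@in_batch_ni 1) h; rewrite /base mod0n x0 // h.
  by case/andP=> _; apply: x0.
have {}r0 : 0 < r by rewrite lt0n.
move=> [ib later]; set y := [ffun _ => _].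
have blt := base_lt r.
have yE (j : 'I_n) : y j = (if in_batch s q r j then (base q r).+1 else x j) :> nat.
  by rewrite ffunE; case: ifP => // _; rewrite inord_le.
have Q0 : 0 < q.-1 by lia.
split; last first.
- move=> j jni; apply: ord_inj; rewrite yE; case: ifP => // /in_batch_ni jlt.
  by have : j < ni by [apply: jlt; lia]; lia.
- by move=> j; rewrite yE; case: ifP => // /ib/andP[].
have bE : base q r.+1 = if q.-1 %| r then 0 else (base q r).+1.
  by rewrite /base /= -{1 2}(prednK r0) modnS.
have fE : first_cell s q r.+1 = (q.-1 %| r) * index_set_size s + first_cell s q r.
  by rewrite /first_cell /= -{1 2}(prednK r0) divnS // mulnDl.
have ni_lt := in_batch_ni (r := r.+1).
split=> j hj; rewrite yE.
  have jni : j < ni by apply: ni_lt hj; lia.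
  move: hj; rewrite /in_batch fE bE; case: (q.-1 %| r) => /=.
    by move=> h; rewrite ifF ?later //; lia.
  by rewrite add0n => ->.
rewrite /in_batch ifF; last by move: hj; rewrite fE; lia.
by apply: later; move: hj; rewrite fE; lia.
Qed.

(** * Stage 0: the shape of a block and the bit that it represents *)

Lemma position0 b t : position s q 0 b t = ni + b * K + t.
Proof. by rewrite /position block_sizeE // subn0. Qed.

Lemma position0_block b t : b < M -> t < K ->
  exists2 j : 'I_n, j = position s q 0 b t :> nat & j \in blk 0 b.
Proof.
move=> bM tK; have h : position s q 0 b t < n.
  have := @m_le; rewrite position0; have : b.+1 * K <= M * K by rewrite leq_mul2r bM orbT.
  by rewrite mulSn; case: (M) bM => // M' _ h1 /(_ isT); lia.
exists (Ordinal h) => //; rewrite inE /= !position0 addn0 block_sizeE // subn0.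
by lia.
Qed.

Lemma block0_position b (j : 'I_n) : j \in blk 0 b ->
  exists2 t, t < K & j = position s q 0 b t :> nat.
Proof.
rewrite inE !position0 addn0 block_sizeE // subn0 => h.
by exists (j - (ni + b * K)); rewrite ?position0; lia.
Qed.

(** Level of the [t]-th cell in the cyclic filling order after [c] increases. Truncated subtraction
    gives 0 for the cells not yet reached. *)
Definition cell_fill c t := minn q.-1 (c - t * q.-1).

(* Block b has been filled from cell i by c one-level increases. *)
Definition filled x b i c :=
  [/\ i < K, c <= K * q.-1,
      forall t, t < K -> level x (position s q 0 b ((i + t) %% K)) = cell_fill c t
    & \sum_(j in blk 0 b) x j = c].

Lemma shift_ord i t : i < K -> t < K ->
  exists2 t', t' < K & t = (i + t') %% K.
Proof.
move=> iK tK; case: (leqP i t) => it.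
  by exists (t - i); [lia|rewrite subnKC // modn_small].
by exists (t + K - i); [lia|rewrite subnKC ?modnDr ?modn_small //; lia].
Qed.

Lemma filled_eq x y b i c : b < M ->
  {in blk 0 b, forall j, x j = y j :> nat} -> filled x b i c -> filled y b i c.
Proof.
move=> bM xy [iK cK lev sum]; split=> //; last by rewrite -sum; apply/esym/eq_bigr.
move=> t tK; rewrite -lev //; have [j jE jb] := position0_block bM (ltn_pmod (i + t) (ltnW K_gt1)).
by rewrite -jE !level_ord xy.
Qed.

Lemma filled_full x b i c : b < M -> filled x b i c ->
  full x (blk 0 b) = (c == K * q.-1).
Proof.
move=> bM [iK cK lev sum]; apply/idP/eqP => [/sum_full|cE].
  by rewrite sum card_block ?mul1n // block_sizeE // subn0.
apply: contraT => /not_fullP[j jb].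
have [t tK jE] := block0_position jb; have [t' t'K tE] := shift_ord iK tK.
rewrite -level_ord jE tE lev // /cell_fill cE -mulnBl.
by have : q.-1 <= (K - t') * q.-1 by [rewrite leq_pmull // subn_gt0]; lia.
Qed.

Lemma filled_empty x b i c : filled x b i c -> empty x (blk 0 b) = (c == 0).
Proof.
by move=> [_ _ _ <-]; rewrite sum_nat_eq0.
Qed.

Lemma filled_active x b i c : b < M -> filled x b i c ->
  active x (blk 0 b) = (0 < c < K * q.-1).
Proof.
move=> bM fx; rewrite /active (filled_full bM fx) (filled_empty fx).
by have [_ cK _ _] := fx; lia.
Qed.

Lemma filled_parity x b i c : filled x b i c -> parity x (blk 0 b) = odd c.
Proof. by case=> _ _ _ sum; rewrite /parity sum. Qed.

(** If [c <= (K - 1) * (q - 1)], the last cell in the filling order is still 0. Levels do not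
    increase along that order, so [i] is the first nonzero cell with a zero cyclic predecessor.
    Otherwise no cell is 0 and only the last one, cyclically before [i], is below [q - 1]. *)
Lemma filled_represented x b i c : b < M -> filled x b i c -> 0 < c < K * q.-1 ->
  represented_bit s x b = i.
Proof.
move=> bM [iK cK lev _] /andP[c0 cKQ]; rewrite /represented_bit.
set l := fun t => level x (position s q 0 b (t %% K)).
have K1 := K_gt1; have Q0 : 0 < q.-1 by lia.
have le t : t < K -> l (i + t) = cell_fill c t by apply: lev.
have lK t : l (t + K) = l t by rewrite /l modnDr.
have lge t : i <= t -> t < K -> l t = cell_fill c (t - i).
  by move=> it tK; rewrite -le ?subnKC //; lia.
have llt t : t < i -> l t = cell_fill c (t + K - i).
  by move=> ti; rewrite -le ?subnKC ?lK //; lia.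
rewrite -/(l _); case: (leqP c (K.-1 * q.-1)) => cK1.
  have last0 : l (i + K.-1) = 0 by rewrite le /cell_fill; lia.
  rewrite ifT; last first.
    apply/hasP; exists ((i + K.-1) %% K); first by rewrite mem_iota ltn_pmod // expn_gt0.
    by rewrite modn_mod -/(l _) last0.
  apply: (@find_iota (fun t => (l t != 0) && (l (t + K.-1) == 0))) => //=.
    by rewrite last0 lge // subnn /cell_fill; lia.
  move=> t ti; rewrite negb_and negbK orbC.
  have -> : t + K.-1 = i + (t + K - i).-1 by lia.
  rewrite le ?llt //; last by lia.
  rewrite /cell_fill; have : (t + K - i).-1 * q.-1 <= (t + K - i) * q.-1.
    by rewrite leq_mul2r leq_pred orbT.
  by case: eqVneq => //=; lia.
have small t : t < K.-1 -> cell_fill c t = q.-1.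
  move=> tK; have : t.+1 * q.-1 <= K.-1 * q.-1 by rewrite leq_mul2r tK orbT.
  by rewrite mulSn /cell_fill; lia.
have last_lt : 0 < cell_fill c K.-1 < q.-1.
  move: cKQ; rewrite -{1}(prednK (ltnW K1)) mulSn /cell_fill; lia.
have pos t : t < K -> 0 < cell_fill c t.
  move=> tK; have [/small->//|h] := ltnP t K.-1.
  by have -> : t = K.-1 by [lia]; case/andP: last_lt.
rewrite ifF; last first.
  apply/hasP => -[t]; rewrite mem_iota /= => tK; rewrite -/(l _).
  have [it|ti] := leqP i t; first by rewrite lge //; have := pos (t - i); lia.
  by rewrite llt //; have := pos (t + K - i); lia.
(* For [i = 0] the unfilled cell is [K - 1], and its successor wraps around to 0. *)
case: (posnP i) => [i0|i0].
  rewrite (@find_iota (fun t => l t < q.-1) _ K.-1) ?prednK ?modnn //; try lia.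
    by rewrite -/(l _) lge ?i0 ?subn0; lia.
  by move=> t tK; rewrite -/(l _) lge ?i0 ?subn0 ?small; lia.
rewrite (@find_iota (fun t => l t < q.-1) _ i.-1) ?prednK ?modn_small //; try lia.
  rewrite -/(l _) llt; last by lia.
  by have -> : i.-1 + K - i = K.-1 by [lia]; case/andP: last_lt.
by move=> t ti; rewrite -/(l _) llt ?small; lia.
Qed.

(** Write [c = a * (q - 1) + d] with [d < q - 1]. The first [a] cells of the filling order are full
    and the next one is at level [d], so it is the cell to raise. *)
Lemma filled_raise x b i c (y := raise x (position s q 0 b ((i + c %/ q.-1) %% K))) :
  b < M -> filled x b i c -> c < K * q.-1 ->
  [/\ filled y b i c.+1, le_state x y, data_sum y = (data_sum x).+1
    & forall j : 'I_n, j \notin blk 0 b -> y j = x j].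
Proof.
move=> bM [iK cK lev sum] cKQ; have K0 : 0 < K by rewrite expn_gt0.
have Q0 : 0 < q.-1 by lia.
have t0K : c %/ q.-1 < K by rewrite ltn_divLR.
have [j0 j0E j0b] := position0_block bM (ltn_pmod (i + c %/ q.-1) K0).
have cE := divn_eq c q.-1; have cm := ltn_pmod c Q0.
have xj0 : x j0 < q.-1.
  by rewrite -level_ord j0E lev // /cell_fill; lia.
rewrite {}/y -j0E; set y := raise _ _.
have yE : forall j, y j = x j + (j == j0) :> nat := raiseE xj0.
split; last first.
- move=> j jb; apply: ord_inj; rewrite yE; case: eqVneq => [jj0|]; last by rewrite addn0.
  by rewrite jj0 j0b in jb.
- by apply: data_sum_incr => //; apply: block_data j0b.
- by move=> j; rewrite yE leq_addr.
split=> //.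
  move=> t tK; have [j jE jb] := position0_block bM (ltn_pmod (i + t) K0).
  have : level x j = cell_fill c t by rewrite jE lev.
  rewrite -jE !level_ord yE => ->.
  have -> : (j == j0) = (t == c %/ q.-1).
    rewrite -val_eqE /= jE j0E !position0 eqn_add2l eqn_modDl.
    by rewrite !modn_small.
  rewrite /cell_fill; case: (ltngtP t (c %/ q.-1)) => [lt|lt|->] /=.
  - have : t.+1 * q.-1 <= c %/ q.-1 * q.-1 by rewrite leq_mul2r lt orbT.
    rewrite mulSn; lia.
  - have : (c %/ q.-1).+1 * q.-1 <= t * q.-1 by rewrite leq_mul2r lt orbT.
    rewrite mulSn; lia.
  - lia.
rewrite (eq_bigr (fun j => x j + (j == j0))) // big_split /= sum.
by rewrite (bigD1 j0) //= eqxx big1 ?addn0 ?addn1 // => j /andP[_ /negPf->].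
Qed.

Lemma filled_fill x b i c : b < M -> filled x b i c -> c < K * q.-1 ->
  fill s x b i = raise x (position s q 0 b ((i + c %/ q.-1) %% K)).
Proof.
move=> bM [iK cK lev sum] cKQ; rewrite /fill; congr (raise x (position _ _ _ _ _)).
have Q0 : 0 < q.-1 by lia.
have cE := divn_eq c q.-1; have cm := ltn_pmod c Q0.
have t0K : c %/ q.-1 < K by rewrite ltn_divLR.
congr ((i + _) %% _).
apply: find_iota => //; first by rewrite lev // /cell_fill; lia.
move=> t tt; rewrite lev /cell_fill; last by lia.
have : t.+1 * q.-1 <= c %/ q.-1 * q.-1 by rewrite leq_mul2r tt orbT.
rewrite mulSn; lia.
Qed.

Lemma represented_bit_eq x y b : b < M ->
  {in blk 0 b, forall j, x j = y j :> nat} ->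
  represented_bit s x b = represented_bit s y b.
Proof.
move=> bM xy; have K0 : 0 < K by rewrite expn_gt0.
have lev t : level x (position s q 0 b (t %% K)) = level y (position s q 0 b (t %% K)).
  by have [j <- jb] := position0_block bM (ltn_pmod t K0); rewrite !level_ord xy.
(* The represented bit depends on the state only through the cyclic level function; with this
   dependence abstracted, extensionality applies. *)
pose F (l : nat -> nat) :=
  if has (fun t => l t == 0) (iota 0 K)
  then find (fun t => (l t != 0) && (l (t + K.-1) == 0)) (iota 0 K)
  else (find (fun t => l t < q.-1) (iota 0 K)).+1 %% K.
by congr F; apply: funext.
Qed.

(** * Stage 0: decoding and encoding *)

Definition represents x i b := active x (blk 0 b) && (represented_bit s x b == i).

Definition stage0_ok x :=
  [/\ forall j : 'I_n, j < ni -> x j = 0 :> nat,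
      forall b, b < M -> exists i c, filled x b i c
    & forall i b b', b < M -> b' < M -> represents x i b -> represents x i b' -> b = b'].

Definition bit_value0 x l :=
  has (fun b => represents x l b && parity x (blk 0 b)) (iota 0 M).

Lemma decode0E x (l : 'I_K) : stage0_ok x -> decode0 s x l = bit_value0 x l.
Proof.
move=> [_ _ uniq_rep]; rewrite /decode0.
have mem_act b : b \in [seq b <- iota 0 M | active x (blk 0 b)] ->
    b < M /\ active x (blk 0 b).
  by rewrite mem_filter mem_iota => /andP[-> /andP[_ ->]].
(* Represented bits are shifted by one because [foldl_set_bit] reads the value 0 as no bit. *)
rewrite (@foldl_set_bit _ (fun b => (represented_bit s x b).+1)
           (fun b => parity x (blk 0 b))); last first.
- move=> b b' /mem_act[bM ab] /mem_act[bM' ab'] [e] _.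
  by apply: (uniq_rep (represented_bit s x b)); rewrite /represents ?ab ?ab' ?e /=.
- by rewrite filter_uniq ?iota_uniq.
have has_filter (P : pred nat) : has P [seq b <- iota 0 M | active x (blk 0 b)]
    = has (fun b => active x (blk 0 b) && P b) (iota 0 M).
  by elim: (iota 0 M) => //= b bs0 IH; case: (active x _) => /=; rewrite IH.
rewrite !has_filter ffunE [in if _ then _ else _]/=.
have -> : bit_value0 x l = has (fun b => active x (blk 0 b) &&
    (((represented_bit s x b).+1 == l.+1) && parity x (blk 0 b))) (iota 0 M).
  by apply: eq_has => b; rewrite /represents eqSS andbA.
case: ifP => // /negbT nh; apply/esym/negbTE; apply: contra nh => /hasP[b bM].
by case/and3P => h1 h2 _; apply/hasP; exists b; rewrite ?h1.
Qed.

(** The case [c = 0] is included: block [b] then represents nothing and both sides are false. This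
    gives the old value of the bit when an empty block is about to be opened. *)
Lemma bit_value0_at x b i c : b < M -> filled x b i c -> c < K * q.-1 ->
  (forall b', b' < M -> represents x i b' -> b' = b) ->
  bit_value0 x i = odd c.
Proof.
move=> bM fx cKQ rep_b; apply/hasP/idP => [[b']|oddc].
  rewrite mem_iota => /andP[_ b'M] /andP[/rep_b-> //].
  by rewrite (filled_parity fx).
have cb : 0 < c < K * q.-1 by rewrite cKQ andbT; case: c oddc {fx cKQ}.
exists b; first by rewrite mem_iota.
rewrite /represents (filled_active bM fx) cb (filled_represented bM fx cb) eqxx.
by rewrite (filled_parity fx).
Qed.

(* A block that has just become full represents nothing, and its K(q-1) levels
   have even sum, in agreement with the bit being 0 by default. *)
Lemma raise_step x b i c (y := raise x (position s q 0 b ((i + c %/ q.-1) %% K))) :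
  stage0_ok x -> b < M -> filled x b i c -> c < K * q.-1 ->
  (forall b', b' < M -> represents x i b' -> b' = b) ->
  [/\ stage0_ok y, le_state x y, data_sum y = (data_sum x).+1
    & forall l, bit_value0 y l = bit_value0 x l (+) (l == i)].
Proof.
move=> [x0 fillx repx] bM fx cKQ rep_b.
have [fy ley sy yx] := filled_raise bM fx cKQ; rewrite -/y in fy ley sy yx.
have other b' : b' != b -> {in blk 0 b', forall j, y j = x j :> nat}.
  move=> bb' j jb'; rewrite yx //; apply/negP => jb.
  by case/eqP: bb'; apply: block_inj jb' jb.
have rep_other l b' : b' < M -> b' != b -> represents y l b' = represents x l b'.
  move=> b'M bb'; rewrite /represents (represented_bit_eq b'M (other _ bb')).
  congr (_ && _); rewrite /active (full_eq (other _ bb')); congr (_ && ~~ _).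
  by apply: eq_forallb_in => j jb; rewrite (other _ bb').
have repy_b l : represents y l b -> l = i.
  rewrite /represents (filled_active bM fy) => /andP[cb /eqP<-].
  exact: filled_represented fy cb.
have repx_b l : represents x l b -> l = i.
  rewrite /represents (filled_active bM fx) => /andP[cb /eqP<-].
  exact: filled_represented fx cb.
have repy_i b' : b' < M -> represents y i b' -> b' = b.
  by move=> b'M; case: (eqVneq b' b) => // bb'; rewrite rep_other //; apply: rep_b.
split=> //.
  split.
  - move=> j jni; rewrite yx ?x0 //; apply/negP => /block_data h.
    by have := h (leq0n _); lia.
  - move=> b' b'M; case: (eqVneq b' b) => [->|bb']; first by exists i, c.+1.
    have [i' [c' fx']] := fillx _ b'M; exists i', c'.
    by apply: filled_eq fx' => // j jb'; rewrite (other _ bb').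
  - move=> l b1 b2 b1M b2M r1 r2.
    have [li|li] := eqVneq l i.
      by rewrite li in r1 r2; rewrite (repy_i _ b1M r1) (repy_i _ b2M r2).
    have ne b' : represents y l b' -> b' != b.
      by move=> r'; apply/eqP => bb'; move: r'; rewrite bb' => /repy_b/eqP; rewrite (negPf li).
    by apply: (repx l); rewrite // -rep_other ?ne.
move=> l; have [->|li] := eqVneq l i; last first.
  rewrite addbF; apply: eq_in_has => b'; rewrite mem_iota => /andP[_ b'M].
  case: (eqVneq b' b) => [->|bb']; last first.
    by rewrite rep_other // (parity_eq (other _ bb')).
  have -> : represents y l b = false by apply: contraNF li => /repy_b->.
  by have -> : represents x l b = false by apply: contraNF li => /repx_b->.
rewrite addbT (bit_value0_at bM fx cKQ rep_b).
have [cKQ'|cKQ'] := ltnP c.+1 (K * q.-1).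
  by rewrite (bit_value0_at bM fy cKQ' repy_i) /=.
have cE : c.+1 = K * q.-1 by lia.
have -> : odd c.
  rewrite -[odd c]negbK -[~~ odd c]/(odd c.+1) cE -(prednK s_gt0) expnS -mulnA.
  by rewrite oddM.
apply/hasP => -[b']; rewrite mem_iota => /andP[_ b'M] /andP[rb' _].
by move: (rb'); rewrite (repy_i b') // /represents (filled_active bM fy) cE ltnn andbF.
Qed.

(** An empty block fits every starting cell, so opening it for bit [i] is a case of [raise_step]. *)
Lemma filled_zero x b i i' : b < M -> i' < K -> filled x b i 0 -> filled x b i' 0.
Proof.
move=> bM i'K fx; have [iK cK lev sum] := fx; split=> // t tK.
have [j <- jb] := position0_block bM (ltn_pmod (i' + t) (ltnW K_gt1)).
have /forall_inP/(_ j jb)/eqP : empty x (blk 0 b) by rewrite (filled_empty fx).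
by rewrite level_ord /cell_fill => ->; lia.
Qed.

Lemma encode0_Some x (i : 'I_K) y : stage0_ok x -> encode0 x i = Some y ->
  [/\ stage0_ok y, le_state x y, data_sum y = (data_sum x).+1
    & forall l, bit_value0 y l = bit_value0 x l (+) (l == i)].
Proof.
move=> ok; have [_ fillx repx] := ok; rewrite /encode0.
set P1 := [seq _ <- _ | _]; case E1 : P1 => [|b P1'].
  set P0 := [seq _ <- _ | _]; case E0 : P0 => [//|b P0'] [<-] {y}.
  have : b \in P0 by rewrite E0 mem_head.
  rewrite mem_filter mem_iota => /andP[emp /andP[_ bM]].
  have [i' [c fx]] := fillx _ bM.
  have {}fx : filled x b i 0.
    move: emp; rewrite (filled_empty fx) => /eqP c0.
    by rewrite c0 in fx; exact: (filled_zero bM (ltn_ord i) fx).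
  have := raise_step ok bM fx; rewrite div0n addn0 modn_small; last exact: ltn_ord.
  apply.
    by rewrite muln_gt0 expn_gt0; lia.
  move=> b' b'M r'; have : b' \in P1 by rewrite mem_filter mem_iota; apply/andP.
  by rewrite E1.
move=> [<-]; have : b \in P1 by rewrite E1 mem_head.
rewrite mem_filter mem_iota => /andP[rb /andP[_ bM]].
have [i' [c fx]] := fillx _ bM.
move: (rb); rewrite (filled_active bM fx) => /andP[cb].
rewrite (filled_represented bM fx cb) => /eqP ii'; rewrite {}ii' in fx.
have cKQ : c < K * q.-1 by case/andP: cb.
rewrite (filled_fill bM fx cKQ); apply: raise_step => // b' b'M r'.
exact: (repx i).
Qed.

Lemma encode0_None x (i : 'I_K) : stage0_ok x -> encode0 x i = None ->
  size (live_blocks s 0 x) < K.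
Proof.
move=> [_ fillx repx]; rewrite /encode0.
set P1 := [seq _ <- _ | _]; case E1 : P1 => [|//].
set P0 := [seq _ <- _ | _]; case E0 : P0 => [|//] _.
(* No empty block is left, so every live block is active and represents a bit; the same pigeonhole
   count as in the indexed stages follows. *)
have live b : b \in live_blocks s 0 x -> b < M /\ active x (blk 0 b).
  rewrite mem_filter mem_iota mul1n => /andP[nfull /andP[_ bM]]; split=> //.
  rewrite /active nfull /=; apply/negP => emp.
  have : b \in P0 by rewrite mem_filter mem_iota emp.
  by rewrite E0.
rewrite -(size_map (represented_bit s x)).
have -> : K = size ((i : nat) :: rem (i : nat) (iota 0 K)).
  by rewrite /= size_rem ?size_iota ?prednK ?expn_gt0 // mem_iota ltn_ord.
rewrite /= ltnS; apply: uniq_leq_size.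
  rewrite map_inj_in_uniq; first exact: live_blocks_uniq.
  move=> b b' /live[bM ab] /live[b'M ab'] e.
  by apply: (repx (represented_bit s x b)); rewrite // /represents ?ab ?ab' ?e /=.
move=> _ /mapP[b /live[bM ab] ->].
rewrite mem_rem_uniq ?iota_uniq // inE mem_iota /=; apply/andP; split.
  apply/negP => h; have : b \in P1 by rewrite mem_filter mem_iota ab h bM.
  by rewrite E1.
have [i' [c fx]] := fillx _ bM; move: ab; rewrite (filled_active bM fx) => cb.
by rewrite (filled_represented bM fx cb); case: fx.
Qed.

(** * The stages in sequence: reading the current stage and counting losses *)

(** This part of the invariant also holds at a stage whose transition has returned [None], where
    [good] may fail. *)
Definition index_inv r x :=
  if r == 0 then forall j : 'I_n, j < ni -> x j = 0 :> nat else index_ok r x.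

Definition stage_inv r x :=
  if r == 0 then stage0_ok x else good r x /\ started s r x.

Definition stage_bit r x l := if r == 0 then bit_value0 x l else bit_value r x l.

Lemma stage_index_inv r x : stage_inv r x -> index_inv r x.
Proof.
by rewrite /stage_inv /index_inv; case: eqP => _ [] // [].
Qed.

(** If the two stages share a set of cells, the levels are at most [base r + 1 <= base r'].
    Otherwise stage [r'] uses a later set, which is still at level 0. *)
Lemma not_started r r' x : r < r' < s -> index_inv r x -> ~~ started s r' x.
Proof.
move=> /andP[rr' r's] inv; apply/existsPn => j; rewrite negb_and -leqNgt -implybE.
apply/implyP => jb; have jni : j < ni by apply: in_batch_ni jb; lia.
move: inv; rewrite /index_inv; case: eqP => [_ ->//|/eqP r0 [ib later]].
have Q0 : 0 < q.-1 by lia.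
have : r.-1 %/ q.-1 <= r'.-1 %/ q.-1 by apply: leq_div2r; lia.
rewrite leq_eqVlt => /orP[/eqP e|lt].
  apply: leq_trans (_ : (base q r).+1 <= _).
    have := ib j; rewrite /in_batch /first_cell e -/(first_cell _ _ _) => /(_ jb).
    by case/andP.
  have := divn_eq r.-1 q.-1; have := divn_eq r'.-1 q.-1; rewrite /base e; lia.
rewrite later ?jni ?andbT //; have : first_cell s q r + index_set_size s <= first_cell s q r'.
  by rewrite /first_cell addnC -mulSn leq_mul2r lt orbT.
by move=> h; apply: leq_trans h _; case/andP: jb.
Qed.

Lemma current_stageE r x : r < s -> stage_inv r x -> current_stage s x = r.
Proof.
move=> rs inv; apply/eqP; rewrite eqn_leq; apply/andP; split.
  apply/bigmax_leqP => r' /andP[_ st]; rewrite leqNgt; apply/negP => rr'.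
  have : r < r' < s by rewrite rr' ltn_ord.
  by move/not_started/(_ (stage_index_inv inv)); rewrite st.
case: (posnP r) => [->//|r0].
apply: (leq_bigmax_cond (F := fun r' : 'I_s => nat_of_ord r') (Ordinal rs)).
by move: inv; rewrite /stage_inv /= r0 eqn0Ngt r0 => -[].
Qed.

Lemma decode_stageE r x (l : 'I_K) : stage_inv r x -> decode_stage s r x l = stage_bit r x l.
Proof.
rewrite /stage_inv /decode_stage /stage_bit; case: eqP => _.
  exact: decode0E.
by case=> gx _; apply: decode_indexedE.
Qed.

Lemma encode_stage_Some r x (i : 'I_K) y :
  r < s -> stage_inv r x -> encode_stage pick r x i = Some y ->
  [/\ stage_inv r y, le_state x y, data_sum y <= (data_sum x).+1
    & forall l, stage_bit r y l = stage_bit r x l (+) (l == i)].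
Proof.
rewrite /stage_inv /encode_stage /stage_bit; case: (eqVneq r 0) => [->|r0] rs.
  by move=> ok /(encode0_Some ok)[? ? -> ?].
have rs' : 0 < r < s by rewrite lt0n r0.
move=> [gx st] /(encode_indexed_Some rs' gx)[gy ley sy by_].
by split=> //; split=> //; apply: started_le st.
Qed.

Lemma encode_stage_None r x (i : 'I_K) :
  stage_inv r x -> encode_stage pick r x i = None -> size (live_blocks s r x) < K.
Proof.
rewrite /stage_inv /encode_stage; case: (eqVneq r 0) => [->|r0].
  exact: encode0_None.
by move=> [gx _]; apply: encode_indexed_None.
Qed.

(** Block by block: a full block contributes its whole capacity to [data_sum], and a live block is
    credited with its capacity in the second summand. *)
Lemma data_sum_ge r x : r <= s ->
  2 ^ r * M * (bs r * q.-1) <= data_sum x + size (live_blocks s r x) * (bs r * q.-1).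
Proof.
move=> rs; set B := 2 ^ r * M.
have -> : size (live_blocks s r x) = \sum_(b < B) ~~ full x (blk r b).
  rewrite size_filter -sum1_count big_mkcond /= -[B in iota _ B]subn0 -/(index_iota _ _).
  by rewrite big_mkord; apply: eq_bigr => b _; case: full.
have le1 : \sum_(b < B) \sum_(j in blk r b) x j <= data_sum x.
  (* After the exchange of sums, disjointness of blocks says that each data cell is counted at most
     once. *)
  rewrite (exchange_big_dep (fun j : 'I_n => ni <= j)) /=; last first.
    by move=> b j _; apply: block_data.
  apply: leq_sum => j _; have [[b0 jb0]|none] := pselect (exists b : 'I_B, j \in blk r b).
    rewrite (bigD1 b0) //= big1 ?addn0 // => b /andP[jb /eqP bb0].
    by case: bb0; apply: ord_inj; apply: block_inj jb jb0.
  by rewrite big_pred0 // => b; apply/negP => jb; apply: none; exists b.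
apply: leq_trans (leq_add le1 (leqnn _)).
rewrite big_distrl /= -big_split /= -{1}(card_ord B) -sum_nat_const.
apply: leq_sum => b _; case: (boolP (full x (blk r b))) => [/sum_full->|_] /=.
  by rewrite card_block // addn0.
by rewrite mul1n leq_addl.
Qed.

(** The quantity [data_sum - K * r], written without subtraction, grows by at most 1 for the write:
    each stage entered gains a credit [K] that pays for recording the bits. In the case [None] the
    same quantity is bounded below by the capacity of the blocks, up to the losses. *)
Lemma next_stages_spec d r v x i : d + r = s.-1 -> index_inv r x ->
  size (live_blocks s r x) < K ->
  match next_stages pick d r v x i with
  | Some y => exists r', [/\ r' < s, stage_inv r' y, le_state x y,
      data_sum y + K * r <= data_sum x + K * r' + 1
      & forall l : 'I_K, stage_bit r' y l = v l (+) (l == i)]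
  | None => M * K * q.-1 + K * r <= data_sum x + K * s + 2 * K * q.-1
  end.
Proof.
elim: d r x => [|d IH] r x /= ds inv sz.
  (* Here [r = s - 1]: blocks have two cells and fewer than [K] of them are live. *)
  have rs : r <= s by lia.
  have := data_sum_ge x rs; have bE : bs r = 2 by rewrite block_sizeE // (_ : s - r = 1) //; lia.
  have -> : 2 ^ r * M * (bs r * q.-1) = M * K * q.-1.
    by rewrite -(block_size_mul rs); nia.
  rewrite bE; have : size (live_blocks s r x) * (2 * q.-1) <= K * (2 * q.-1).
    by rewrite leq_mul2r (ltnW sz) orbT.
  have : K * r <= K * s by rewrite leq_mul2l rs orbT.
  lia.
have rs : r.+1 < s by lia.
have rs' : 0 < r.+1 < s by [].
have [fr le1 data1] := close_batch_step rs inv.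
set x1 := close_batch s r x in fr le1 data1 *.
have sum1 : data_sum x1 = data_sum x by apply: data_sum_eq => j /data1->.
have sz1 : size (live_blocks s r.+1 x1) <= nb.
  rewrite (live_blocks_eq (ltnW rs) (y := x)); last by move=> j /data1->.
  apply: leq_trans (size_live_blocks_refine _ (ltnW rs)) _.
  by rewrite /n_index_blocks leq_mul2l /=; lia.
have ds' : d + r.+1 = s.-1 by lia.
case E : (transition pick r.+1 v x1) => [x2|]; last first.
  (* A transition returns [None] only for lack of [K] live blocks, which is the hypothesis needed to
     go on to the next stage. *)
  have szK : size (live_blocks s r.+1 x1) < K.
    by move: E; rewrite /transition; case: ifP.
  have := IH r.+1 x1 ds' (fresh_index_ok fr) szK; rewrite sum1.
  case: (next_stages _ _ _ _ _ _) => [y [r' [h1 h2 h3 h4 h5]]|].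
    exists r'; split=> //; first exact: le_state_trans le1 h3.
    by rewrite mulnS in h4; lia.
  by rewrite mulnS; lia.
have [g2 st2 le2 sum2 bit2] := transition_Some rs' fr sz1 E.
have inv2 : stage_inv r.+1 x2 by [].
have le12 := le_state_trans le1 le2.
case E2 : (encode_stage pick r.+1 x2 i) => [y|].
  have [invy ley sumy bity] := encode_stage_Some rs inv2 E2.
  exists r.+1; split=> //; first exact: le_state_trans le12 ley.
    by rewrite mulnS; lia.
  by move=> l; rewrite bity /stage_bit /= bit2.
have := IH r.+1 x2 ds' (good_index g2) (encode_stage_None inv2 E2).
case: (next_stages _ _ _ _ _ _) => [y [r' [h1 h2 h3 h4 h5]]|].
  exists r'; split=> //; first exact: le_state_trans le12 h3.
  by rewrite mulnS in h4; lia.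
by rewrite mulnS; lia.
Qed.

Lemma encode_all_spec r x i : r < s -> stage_inv r x ->
  match encode_all pick x i with
  | Some y => exists r', [/\ r' < s, stage_inv r' y, le_state x y,
      data_sum y + K * r <= data_sum x + K * r' + 1
      & forall l : 'I_K, decode_all s y l = decode_all s x l (+) (l == i)]
  | None => M * K * q.-1 + K * r <= data_sum x + K * s + 2 * K * q.-1
  end.
Proof.
move=> rs inv; have dE r' y (l : 'I_K) : r' < s -> stage_inv r' y ->
    decode_all s y l = stage_bit r' y l.
  by move=> r's invy; rewrite /decode_all (current_stageE r's invy) decode_stageE.
rewrite /encode_all (current_stageE rs inv).
case E : (encode_stage pick r x i) => [y|].
  have [invy ley sumy bity] := encode_stage_Some rs inv E.
  by exists r; split=> //; [lia|move=> l; rewrite !(dE r) ?bity].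
have ds : s.-1 - r + r = s.-1 by lia.
have := next_stages_spec (decode_all s x) i ds (stage_index_inv inv) (encode_stage_None inv E).
case: (next_stages _ _ _ _ _ _) => // y [r' [h1 h2 h3 h4 h5]].
by exists r'; split=> // l; rewrite (dE r') // h5.
Qed.

Lemma initial_stage_inv : stage_inv 0 (initial q n).
Proof.
have active0 b : active (initial q n) (blk 0 b) = false.
  apply/andP => -[_ /negP[]]; apply/forall_inP => j _; by rewrite ffunE.
split=> [j _|b bM|i b b' _ _]; first by rewrite ffunE.
  exists 0, 0; split=> //; first by rewrite expn_gt0.
    move=> t tK; rewrite /cell_fill sub0n minn0.
    have [j <- _] := position0_block bM (ltn_pmod (0 + t) (ltnW K_gt1)).
    by rewrite level_ord ffunE.
  by rewrite big1 // => j _; rewrite ffunE.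
by rewrite /represents active0.
Qed.

(** * Sequences of writes *)

Lemma write_seq_rcons k (C : code_maps k q n) w i :
  write_seq C (rcons w i) = obind (encode C ^~ i) (write_seq C w).
Proof. by rewrite /write_seq foldl_rcons. Qed.

(** The term [K * r] pays for the transitions into stages 1, ..., r. *)
Lemma write_seq_inv w x : write_seq (code_pow2 s pick) w = Some x ->
  exists r, [/\ r < s, stage_inv r x & data_sum x <= size w + K * r].
Proof.
elim/last_ind: w x => [|w i IH] x.
  move=> [<-]; exists 0; split=> //; first exact: initial_stage_inv.
  by rewrite /data_sum big1 // => j _; rewrite ffunE.
rewrite write_seq_rcons; case E : (write_seq _ w) => [z|//] /= Ez.
have [r [rs inv sz]] := IH z E.
have := encode_all_spec i rs inv; rewrite Ez => -[r' [h1 h2 h3 h4 _]].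
by exists r'; split=> //; rewrite size_rcons; lia.
Qed.

Lemma flash_code_pow2 : flash_code (code_pow2 s pick).
Proof.
move=> w x y i /write_seq_inv[r [rs inv _]] E.
have := encode_all_spec i rs inv; rewrite -[encode_all _ _ _]/(encode (code_pow2 s pick) x i) E.
move=> [r' [_ _ ley _ bity]]; split=> // l.
by rewrite [Defs.decode _ y l]bity [Defs.decode _ x l]/=; case: (decode_all s x l); case: (l == i).
Qed.

Lemma write_seq_stop w x i :
  write_seq (code_pow2 s pick) w = Some x -> encode_all (s := s) pick x i = None ->
  M * K * q.-1 <= size w + K * s + 2 * K * q.-1.
Proof.
move=> /write_seq_inv[r [rs inv sz]] E.
by have := encode_all_spec i rs inv; rewrite E; lia.
Qed.

End Construction.

(** * Restriction to [k] bits, and the deficiency as a natural number *)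

Lemma write_seq_restrict k K q n (le_kK : k <= K) (C : code_maps K q n) w :
  write_seq (restrict_code le_kK C) w = write_seq C (map (widen_ord le_kK) w).
Proof. by rewrite /write_seq; elim: w (Some _) => //=. Qed.

Lemma flash_code_restrict k K q n (le_kK : k <= K) (C : code_maps K q n) :
  flash_code C -> flash_code (restrict_code le_kK C).
Proof.
move=> fC w x y i; rewrite write_seq_restrict => wx E.
have [le_xy dec] := fC _ _ _ _ wx E; split=> // l.
by rewrite !ffunE dec.
Qed.

(** A sequence that meets the erasure symbol has at least [n * (q - 1) - B] writes behind it, so
    this many writes are guaranteed. If [B] exceeds [n * (q - 1)], the truncated difference is 0. *)
Lemma write_deficiency_le k q n (C : code_maps k q n) B :
  (forall w x i, write_seq C w = Some x -> Defs.encode C x i = None ->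
     n * q.-1 <= size w + B) ->
  write_deficiency C <= B.
Proof.
move=> stop; set t := n * q.-1 - B.
have ok w : size w <= t -> isSome (write_seq C w).
  elim/last_ind: w => [//|w i IH]; rewrite size_rcons write_seq_rcons => wt.
  case E : (write_seq C w) (IH (ltnW wt)) => [x|//] _ /=.
  case E' : (Defs.encode C x i) => [//|].
  have := stop w x i E E'; move: wt; rewrite /t; lia.
have tg : guarantees C t.
  apply/forallP => j; apply/forallP => w; apply: ok.
  by rewrite size_tuple -ltnS ltn_ord.
have tn : t < (n * q.-1).+1 by rewrite ltnS leq_subr.
have : t <= \max_(t < (n * q.-1).+1 | guarantees C t) t.
  by apply: (leq_bigmax_cond (F := fun t : 'I_(n * q.-1).+1 => nat_of_ord t) (Ordinal tn)).
by rewrite /write_deficiency /t; lia.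
Qed.

(** Rounding up costs less than [q], which gives the factor [s + q]. From [K + 2 <= 2 ^ (s + 1)]
    comes [mu' <= s + 1 <= 2 * s], and there are at most [2 * K] index blocks. *)
Lemma n_index_cells_le s q : 0 < s -> 1 < q ->
  n_index_cells s q * q.-1 <= (s + q) * (4 * 2 ^ s * s).
Proof.
move=> s0 q1; rewrite /n_index_cells mulnAC.
have Q0 : 0 < q.-1 by lia.
apply: leq_mul.
  by apply: leq_trans (leq_trunc_div _ _) _; lia.
have mu_le : mu' s <= 2 * s.
  apply: leq_trans (_ : s.+1 <= _); last by lia.
  apply: up_log_min => //; rewrite expnS; have := leq_pexp2l (isT : 0 < 2) s0; lia.
apply: (@leq_trans (2 * 2 ^ s * (2 * s))); last by lia.
by apply: leq_mul => //; rewrite leq_mul2l leq_subr orbT.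
Qed.

(** The losses are the index cells, [2 * K * (q - 1)] for the blocks live at the end, [K * (q - 1)]
    for the leftover cells, and [K * s] for the transitions. *)
Lemma write_deficiency_code_C' k q n (pick : cell_choice q n) (s := up_log 2 k) :
  1 < k -> 1 < q -> valid_choice pick ->
  write_deficiency (code_C' k pick) <= (s + q) * (4 * 2 ^ s * s) + 3 * 2 ^ s * q + 2 ^ s * s.
Proof.
move=> k1 q1 pickP; have s0 : 0 < s by rewrite up_log_gt0.
apply: leq_trans (_ : n_index_cells s q * q.-1 + 3 * 2 ^ s * q.-1 + 2 ^ s * s <= _); last first.
  rewrite leq_add2r leq_add ?n_index_cells_le // leq_mul2l leq_pred orbT //.
apply: write_deficiency_le => w x i; rewrite write_seq_restrict => wx E.
have := write_seq_stop s0 q1 pickP wx E; rewrite size_map.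
have n_le : n <= m s q n * 2 ^ s + n_index_cells s q + 2 ^ s.
  have := divn_eq (n - n_index_cells s q) (2 ^ s); rewrite -/(m s q n).
  have : (n - n_index_cells s q) %% 2 ^ s < 2 ^ s by rewrite ltn_mod expn_gt0.
  lia.
have := leq_mul n_le (leqnn q.-1); rewrite !mulnDl; lia.
Qed.

(** * Passage to logarithms and the final estimates over the reals *)

Local Open Scope ring_scope.
Import Order.TTheory GRing.Theory Num.Theory.

(** With [s = up_log 2 k], the inequality [2 ^ (s - 1) < k] gives [s <= log2 k + 1], and
    [log2 k >= 1] absorbs the added 1. *)
Lemma up_log2_log2 (R : realType) k : (1 < k)%N ->
  (1 <= log2 (k%:R : R)) /\ ((up_log 2 k)%:R <= 2 * log2 (k%:R : R)).
Proof.
move=> k1; have ln2 : 0 < ln (2 : R) by rewrite ln_gt0 // ltr1n.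
have L1 : 1 <= log2 (k%:R : R).
  by rewrite /log2 ler_pdivlMr // mul1r ler_ln ?posrE ?ltr0n ?ler_nat // ltnW.
split=> //.
have : (up_log 2 k).-1%:R <= log2 (k%:R : R).
  rewrite /log2 ler_pdivlMr // mulr_natl -lnXn ?ltr0n //.
  rewrite ler_ln ?posrE ?exprn_gt0 ?ltr0n //; last lia.
  by rewrite -natrX ler_nat ltnW // up_log_gtn.
have : (0 < up_log 2 k)%N by rewrite up_log_gt0.
case: (up_log 2 k) => [//|j] _ /=; rewrite -addn1 natrD; lra.
Qed.

(** [S] stands for the number of stages, [P] for [2 ^ s] and [L] for [log2 k]; the left side is
    monotone in [S] and [P], which are replaced by [2 * L] and [2 * k]. *)
Lemma code_C'_real_bound (R : realFieldType) (S P q k L : R) :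
  0 <= S <= 2 * L -> 0 <= P <= 2 * k -> 0 <= q -> 1 <= L ->
  (S + q) * (4 * P * S) + 3 * P * q + P * S
    <= k * (32 * L ^+ 2 + 16 * (q * L) + 6 * q + 4 * L).
Proof.
move=> /andP[S0 SL] /andP[P0 Pk] q0 L1.
have k0 : 0 <= k by lra.
apply: (@le_trans _ _ (P * ((S + q) * (4 * S) + 3 * q + S))); first by lra.
apply: (@le_trans _ _ (2 * k * ((2 * L + q) * (4 * (2 * L)) + 3 * q + 2 * L))); last by lra.
apply: ler_pM => //; first by rewrite !addr_ge0 ?mulr_ge0 ?addr_ge0.
rewrite !lerD // ler_pM ?addr_ge0 ?mulr_ge0 ?lerD //; lra.
Qed.

Theorem theorem4 (R : realType) :
  exists c : R, 0 < c /\
    forall (k q n : nat) (pick : cell_choice q n),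
      (2 <= k)%N -> (2 <= q)%N -> (k ^ 2 <= n)%N -> valid_choice pick ->
      flash_code (code_C' k pick) /\
      (log2 (k%:R : R) <= q%:R ->
         (write_deficiency (code_C' k pick))%:R
           <= c * (q%:R * k%:R * log2 k%:R)) /\
      (q%:R < log2 (k%:R : R) ->
         (write_deficiency (code_C' k pick))%:R
           <= c * (k%:R * log2 k%:R ^+ 2)).
Proof.
(* The constant is the sum 32 + 16 + 6 + 4 of the coefficients in [code_C'_real_bound]. *)
exists 58; split=> [|k q n pick k1 q1 _ pickP]; first by lra.
split.
  by apply: flash_code_restrict; apply: flash_code_pow2; rewrite ?up_log_gt0.
have [L1 SL] := up_log2_log2 R k1.
have def_le := write_deficiency_code_C' k1 q1 pickP.
set d := write_deficiency _ in def_le *; set L := log2 _ in L1 SL *.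
have pow_le : (2 ^ up_log 2 k <= 2 * k)%N.
  rewrite -(prednK (_ : 0 < up_log 2 k)%N) ?up_log_gt0 // expnS leq_mul2l /= ltnW //.
  by rewrite up_log_gtn.
have {def_le} : d%:R <= k%:R * (32 * L ^+ 2 + 16 * (q%:R * L) + 6 * q%:R + 4 * L).
  apply: le_trans (code_C'_real_bound (S := (up_log 2 k)%:R) (P := (2 ^ up_log 2 k)%:R) _ _ _ L1).
  - by rewrite -!natrM -!natrD -!natrM -!natrD ler_nat.
  - by rewrite ler0n.
  - by rewrite ler0n -natrM ler_nat.
  - by rewrite ler0n.
have q1R : 2 <= q%:R :> R by rewrite ler_nat.
have k0 : 0 <= k%:R :> R by rewrite ler0n.
move=> dle; split=> [Lq|qL]; apply: le_trans dle _.
  (* As [1 <= L <= q], each of [L ^+ 2], [q] and [L] is at most [q * L]. *)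
  have le_qL : 32 * L ^+ 2 + 16 * (q%:R * L) + 6 * q%:R + 4 * L <= 58 * (q%:R * L) by nra.
  by have := ler_wpM2l k0 le_qL; lra.
(* As [q < L] and [1 <= L], each of [q * L], [q] and [L] is at most [L ^+ 2]. *)
have le_LL : 32 * L ^+ 2 + 16 * (q%:R * L) + 6 * q%:R + 4 * L <= 58 * L ^+ 2 by nra.
by have := ler_wpM2l k0 le_LL; lra.
Qed.
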